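(* Assume (A1) and (A2). Then for every $n\in\mathbb N$, every $\lambda\in\mathbb N$ and every $h_n\in\mathsf F(\mathcal X_n)$, the fixed-lag estimator computed from the APF satisfies, as $N\to\infty$, $$\hat\sigma^2_{n,\lambda}(h_n)\ \xrightarrow{\mathbb P}\ \sigma^2_{n\langle\lambda\rangle,n}(h_n).$$
   Context: Notation: $\mathbb N=\{0,1,2,\dots\}$, $\mathbb N^*=\mathbb N\setminus\{0\}$; $\llbracket m,n\rrbracket=\{k\in\mathbb N: m\le k\le n\}$; for a measure $\mu$, a (possibly unnormalised) kernel $K$ and a bounded measurable $h$: $\mu h=\int h\,d\mu$, $Kh(x)=\int h(y)K(x,dy)$, $\mu K(A)=\int K(x,A)\mu(dx)$, $KL(x,A)=\int K(x,dy)L(y,A)$. $\mathsf F(\mathcal X)$ denotes the set of bounded measurable real functions on $(\mathsf X,\mathcal X)$. Model: $(\mathsf X_n,\mathcal X_n)_{n\in\mathbb N}$ are measurable spaces; for each $n$, $L_n:\mathsf X_n\times\mathcal X_{n+1}\to\mathbb R_+$ is a kernel with $\sup_{x}L_n\mathbf 1_{\mathsf X_{n+1}}(x)<\infty$; $L_{k:m}=L_kL_{k+1}\cdots L_m$ if $k\le m$ and $L_{k:m}=\mathrm{id}$ otherwise; $\chi$ is a finite measure on $\mathcal X_0$; $\eta_n=\chi L_{0:n-1}/(\chi L_{0:n-1}\mathbf 1_{\mathsf X_n})$ (normalising constants assumed positive and finite). Algorithmic ingredients: a probability measure $\nu$ on $\mathcal X_0$ with $\chi\ll\nu$ and $w_{-1}=d\chi/d\nu$;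 measurable positive functions $\vartheta_n$ on $\mathsf X_n$ (adjustment multipliers); Markov kernels $P_n$ from $\mathsf X_n$ to $\mathcal X_{n+1}$ and measurable $w_n:\mathsf X_n\times\mathsf X_{n+1}\to\mathbb R_+$ with $\int h(y)L_n(x,dy)=\int h(y)w_n(x,y)P_n(x,dy)$ for all $x\in\mathsf X_n$, $h\in\mathsf F(\mathcal X_{n+1})$. Auxiliary particle filter (APF) with $N\in\mathbb N^*$ particles: draw $\xi_0^1,\dots,\xi_0^N$ i.i.d. from $\nu$ and set $\omega_0^i=w_{-1}(\xi_0^i)$; given $(\xi_n^i,\omega_n^i)_{i=1}^N$, for each $i\in\llbracket1,N\rrbracket$, conditionally independently, draw $I_{n+1}^i\in\llbracket 1,N\rrbracket$ with probability $\omega_n^j\vartheta_n(\xi_n^j)/\sum_{\ell}\omega_n^\ell\vartheta_n(\xi_n^\ell)$ of being $j$, then $\xi_{n+1}^i\sim P_n(\xi_n^{I_{n+1}^i},\cdot)$, and set $\omega_{n+1}^i=w_n(\xi_n^{I_{n+1}^i},\xi_{n+1}^i)/\vartheta_n(\xi_n^{I_{n+1}^i})$. Let $\Omega_n=\sum_i\omega_n^i$ and $\eta_n^Nh=\sum_{i=1}^N\omega_n^ih(\xi_n^i)/\Omega_n$. Assumption (A1): for every $n$, $\vartheta_n$ is bounded and $(x,y)\mapsto w_n(x,y)/\vartheta_n(x)$ is bounded; moreover $w_{-1}$ is bounded. Assumption (A2): for all $n\in\mathbb N$ and $(x,y)\in\mathsf X_n\times\mathsf X_{n+1}$, $w_n(x,y)\vartheta_{n+1}(y)/\vartheta_n(x)>0$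 and $\sup_{(x,y)}w_n(x,y)\vartheta_{n+1}(y)/\vartheta_n(x)<\infty$; moreover $w_{-1}(x)\vartheta_0(x)>0$ for all $x\in\mathsf X_0$ and $\sup_x w_{-1}(x)\vartheta_0(x)<\infty$. Asymptotic variance: for $h\in\mathsf F(\mathcal X_n)$ and $\ell\in\llbracket0,n\rrbracket$, $$\sigma^2_{\ell,n}(h)=\mathbf 1_{\{\ell=0\}}\frac{\chi\big(w_{-1}\{L_{0:n-1}(h-\eta_nh)\}^2\big)}{(\chi L_{0:n-1}\mathbf 1_{\mathsf X_n})^2}+\sum_{m=(\ell-1)\vee0}^{n-1}\eta_m\vartheta_m\,\frac{\int\eta_m(dx)\,\vartheta_m(x)^{-1}\int L_m(x,dy)\,w_m(x,y)\{L_{m+1:n-1}(h-\eta_nh)(y)\}^2}{(\eta_mL_{m:n-1}\mathbf 1_{\mathsf X_n})^2},$$ and $\sigma^2_n(h)=\sigma^2_{0,n}(h)$. Enoch indices and fixed-lag estimator: define $E^i_{n,n}=i$ for all $n$ and $i$, and recursively $E^i_{m,n+1}=E^{I^i_{n+1}}_{m,n}$ for $m\le n$ (so $E^i_{m,n}$ is the index of the time-$m$ ancestor of particle $i$ at time $n$). For $\lambda\in\mathbb N$ let $n\langle\lambda\rangle=(n-\lambda)\vee0$ and $$\hat\sigma^2_{n,\lambda}(h)=N\sum_{i=1}^N\Big(\sum_{j:\,E^j_{n\langle\lambda\rangle,n}=i}\frac{\omega_n^j}{\Omega_n}\{h(\xi_n^j)-\eta_n^Nh\}\Big)^2.$$ 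*)

(* Defs.v *)
From HB Require Import structures.
From mathcomp Require Import all_boot all_order all_algebra.
From mathcomp Require Import all_classical all_reals all_analysis.
Unset Printing Implicit Defensive.
Import Order.TTheory GRing.Theory Num.Theory.
Import numFieldNormedType.Exports.
Local Open Scope classical_set_scope.
Local Open Scope ring_scope.

Section APF.
Context {R : realType}.
Context {dX : nat -> measure_display} {X : forall n, measurableType (dX n)}.

Definition bounded_meas {d} {T : measurableType d} (h : T -> R) : Prop :=
  measurable_fun setT h /\ exists M : R, forall x, `|h x| <= M.

Definition rint {d} {T : measurableType d} (mu : set T -> \bar R) (f : T -> R) : R :=
  fine (\int[mu]_x (f x)%:E)%E.

Section Ops.
Context (L : forall n, R.-fker (X n) ~> (X n.+1)).

Definition Lop n (h : X n.+1 -> R) : X n -> R := fun x => rint (L n x) h.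

Fixpoint Lk (d m : nat) : (X (d + m)%N -> R) -> X m -> R :=
  match d return (X (d + m)%N -> R) -> X m -> R with
  | 0 => fun h => h
  | d'.+1 => fun h => @Lk d' m (Lop (d' + m)%N h)
  end.

Definition castX {a b : nat} (e : a = b) (h : X b -> R) : X a -> R :=
  fun x => h (eq_rect a X x b e).

(* L_{m:n-1} h for m <= n (the identity when m = n); 0 if m > n (unused) *)
Definition Lmn (m n : nat) (h : X n -> R) : X m -> R :=
  match leqP m n with
  | LeqNotGtn le => @Lk (n - m) m (castX (subnK le) h)
  | GtnNotLeq _ => fun _ => 0
  end.

Context (chi : {finite_measure set (X 0%N) -> \bar R}).

Definition chiL n (h : X n -> R) : R := rint chi (Lmn 0%N n h).

Definition eta n (h : X n -> R) : R := chiL n h / chiL n (fun _ => 1).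

Context (wm1 : X 0%N -> R) (theta : forall n, X n -> R)
        (w : forall n, X n -> X n.+1 -> R).

Definition asym_var (l n : nat) (h : X n -> R) : R :=
  let hc := fun x => h x - eta n h in
  (if l == 0%N then
     rint chi (fun x => wm1 x * (Lmn 0%N n hc x) ^+ 2) / (chiL n (fun _ => 1)) ^+ 2
   else 0)
  + \sum_(l.-1 <= m < n)
      eta m (theta m) *
      eta m (fun x => (theta m x)^-1 *
               rint (L m x) (fun y => w m x y * (Lmn m.+1 n hc y) ^+ 2))
      / (eta m (Lmn m n (fun _ => 1))) ^+ 2.
End Ops.

Section Particles.
Context (wm1 : X 0%N -> R) (theta : forall n, X n -> R)
        (w : forall n, X n -> X n.+1 -> R).
Context (N : nat) {dO : measure_display} {Om : measurableType dO}.
Context (xi : forall k, 'I_N -> Om -> X k)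
        (I : forall k : nat, 'I_N -> Om -> 'I_N). (* I k i = I_{k+1}^i *)

Definition omega (k : nat) (i : 'I_N) (o : Om) : R :=
  match k with
  | 0 => wm1 (xi 0%N i o)
  | k'.+1 => w k' (xi k' (I k' i o) o) (xi k'.+1 i o) / theta k' (xi k' (I k' i o) o)
  end.

Definition Omega (k : nat) (o : Om) : R := \sum_(i < N) omega k i o.

Definition etaN (k : nat) (h : X k -> R) (o : Om) : R :=
  \sum_(i < N) omega k i o * h (xi k i o) / Omega k o.

Definition selprob (k : nat) (j : 'I_N) (o : Om) : R :=
  omega k j o * theta k (xi k j o) /
  \sum_(l < N) omega k l o * theta k (xi k l o).

(* Enoch indices: Enoch m n i = E^i_{m,n} (meaningful for m <= n) *)
Fixpoint Enoch (m n : nat) (i : 'I_N) (o : Om) : 'I_N :=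
  match n with
  | 0 => i
  | n'.+1 => if (m <= n')%N then @Enoch m n' (I n' i o) o else i
  end.

Definition sigma_hat (n lam : nat) (h : X n -> R) (o : Om) : R :=
  N%:R * \sum_(i < N)
    (\sum_(j < N | Enoch (n - lam) n j o == i)
        omega n j o / Omega n o * (h (xi n j o) - etaN n h o)) ^+ 2.

Definition history_gen (k : nat) : set (set Om) :=
  [set A | exists m (i : 'I_N) (B : set (X m)),
      (m <= k)%N /\ measurable B /\ A = xi m i @^-1` B]
  `|` [set A | exists m (i j : 'I_N), (m < k)%N /\ A = I m i @^-1` [set j]].

Definition history (k : nat) : set (set Om) := <<s history_gen k >>.

Definition is_APF (nu : probability (X 0%N) R)
    (Pk : forall n, R.-pker (X n) ~> (X n.+1)) (P : probability Om R) : Prop :=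
  (forall k i, measurable_fun setT (xi k i)) /\
  (forall k i j, measurable (I k i @^-1` [set j])) /\
  (forall B : 'I_N -> set (X 0%N), (forall i, measurable (B i)) ->
     P (\bigcap_(i in [set: 'I_N]) (xi 0%N i @^-1` B i)) = (\prod_(i < N) nu (B i))%E) /\
  (* conditionally on F_k, the pairs (I_{k+1}^i, xi_{k+1}^i) are independent,
     I_{k+1}^i = j with prob. selprob k j, and xi_{k+1}^i ~ Pk k (xi_k^{I}, .) *)
  (forall k (A : set Om) (J : 'I_N -> 'I_N) (B : 'I_N -> set (X k.+1)),
     history k A -> (forall i, measurable (B i)) ->
     P (A `&` \bigcap_(i in [set: 'I_N])
              (I k i @^-1` [set J i] `&` xi k.+1 i @^-1` B i)) =
     (\int[P]_(o in A)
        \prod_(i < N) ((selprob k (J i) o)%:E * Pk k (xi k (J i) o) (B i)))%E).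
End Particles.
End APF.

(* Main.v *)
(** The estimator is a quadratic functional of the particle cloud.  Write [Q_n f] for
    [N^-1] times the sum, over the time-[l] ancestors [e], of the squares of the weighted
    sums of [f] over the time-[n] descendants of [e]; up to a vanishing recentring of [h]
    and the normalisation by the total weight, [sigma_hat] is [Q_n (h - eta_n h)] with
    [l = n - lam].  Conditionally on the past the new particles are i.i.d., and the
    conditional mean of [Q_(n+1) f] splits into a diagonal part, governed by the law of
    large numbers for the weighted sample, and an off-diagonal part proportional to
    [Q_n (L_n f)].  Hence the limits obey the recursion satisfied by the unnormalised
    asymptotic variance.

    The fluctuation of [Q_(n+1) f] around its conditional mean is handled by a Hoeffding
    decomposition.  Its linear and degenerate parts are sums of orthogonal increments whose
    second moments are controlled by the sum over the clusters of the squared selection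
    probabilities; that sum equals [Q_n theta_n / (N A^2)], [A] being the weighted mean of
    [theta_n], and so is of order [1/N] by induction.  Markov's inequality is applied on
    the event where it is at most [kap/N]. *)
Require Import Defs.
From HB Require Import structures.
From mathcomp Require Import all_boot all_order all_algebra.
From mathcomp Require Import all_classical all_reals all_analysis.
From mathcomp Require Import measurable_realfun ring lra zify.
Import Order.TTheory GRing.Theory Num.Theory.
Import numFieldNormedType.Exports.
Local Open Scope classical_set_scope.
Local Open Scope ring_scope.

(** * Bounded measurable functions and the functional monotone class theorem *)

(** Conditioning is used in weak form: [m] is the conditional mean of [U] when the integrals of
    [Z * U] and [Z * m] agree for every bounded [Z] measurable for the conditioning sigma-algebra.
    Such identities are checked on a generating pi-system and extended by a monotone class argument.
    For particle [t] the conditioning is on the past together with all the other new particles, not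
    only those of smaller index: every earlier increment is then admissible as a test function, and
    orthogonality needs no filtration inside a generation.

    The obstacle is that no deterministic bound of order [1 / N] holds for the sum of the squared
    cluster probabilities, since one ancestor may carry the whole population. Every moment estimate
    therefore carries a nonnegative past-measurable weight [c], to be replaced by the indicator of
    the event where the bound holds. *)

Lemma measurable_funV {R : realType} {d} {T : measurableType d} (f : T -> R) :
  measurable_fun setT f -> measurable_fun setT (fun x => (f x)^-1).
Proof.
(* The real power is taken of the nonnegative base [f x ^+ 2]; at a zero of [f] both sides are 0,
   the inverse of 0 being 0. *)
move=> mf; rewrite (_ : (fun x => _) = (fun x => f x * (f x ^+ 2) `^ (-1))).
  apply: measurable_funM => //.
  apply: (@measurableT_comp _ _ _ _ _ _ (fun x : R => x `^ (-1))).
    exact: measurable_powR.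
  exact: measurable_funX.
apply/funext => x; rewrite powR_inv1 ?sqr_ge0//.
have [->|x0] := eqVneq (f x) 0; first by rewrite invr0 mul0r.
by field.
Qed.

Section BoundedMeas.
Context {R : realType} {d} {T : measurableType d}.
Implicit Types f g : T -> R.

Lemma bounded_meas_cst (r : R) : bounded_meas (fun _ : T => r).
Proof. by split; [exact: measurable_cst|exists `|r|]. Qed.

Lemma bounded_measD f g : bounded_meas f -> bounded_meas g ->
  bounded_meas (fun x => f x + g x).
Proof.
move=> [mf [M hM]] [mg [K hK]]; split; first exact: measurable_funD.
by exists (M + K) => x; rewrite (le_trans (ler_normD _ _))// lerD.
Qed.

Lemma bounded_measN f : bounded_meas f -> bounded_meas (fun x => - f x).
Proof.
move=> [mf [M hM]]; split; first exact: measurable_funN.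
by exists M => x; rewrite normrN.
Qed.

Lemma bounded_measB f g : bounded_meas f -> bounded_meas g ->
  bounded_meas (fun x => f x - g x).
Proof. by move=> bf bg; apply: bounded_measD => //; exact: bounded_measN. Qed.

Lemma bounded_measM f g : bounded_meas f -> bounded_meas g ->
  bounded_meas (fun x => f x * g x).
Proof.
move=> [mf [M hM]] [mg [K hK]]; split; first exact: measurable_funM.
by exists (M * K) => x; rewrite normrM ler_pM.
Qed.

Lemma bounded_measX f k : bounded_meas f -> bounded_meas (fun x => f x ^+ k).
Proof.
move=> bf; elim: k => [|k IH].
  by under [X in bounded_meas X]eq_fun do rewrite expr0; exact: bounded_meas_cst.
by under [X in bounded_meas X]eq_fun do rewrite exprS; exact: bounded_measM.
Qed.

Lemma bounded_meas_sum {I : Type} (s : seq I) (Q : pred I) (F : I -> T -> R) :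
  (forall i, bounded_meas (F i)) ->
  bounded_meas (fun x => \sum_(i <- s | Q i) F i x).
Proof.
move=> bF; elim: s => [|i s IH].
  by under [X in bounded_meas X]eq_fun do rewrite big_nil; exact: bounded_meas_cst.
under [X in bounded_meas X]eq_fun do rewrite big_cons.
by case: (Q i) => //; exact: bounded_measD.
Qed.

Lemma bounded_meas_prod {I : Type} (s : seq I) (Q : pred I) (F : I -> T -> R) :
  (forall i, bounded_meas (F i)) ->
  bounded_meas (fun x => \prod_(i <- s | Q i) F i x).
Proof.
move=> bF; elim: s => [|i s IH].
  by under [X in bounded_meas X]eq_fun do rewrite big_nil; exact: bounded_meas_cst.
under [X in bounded_meas X]eq_fun do rewrite big_cons.
by case: (Q i) => //; exact: bounded_measM.
Qed.

Lemma bounded_meas_indic (A : set T) : measurable A ->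
  bounded_meas (\1_A : T -> R).
Proof.
move=> mA; split; first exact: measurable_indic.
by exists 1 => x; rewrite indicE; case: (_ \in _); rewrite ?normr1 ?normr0.
Qed.

Lemma bounded_meas_comp {d'} {U : measurableType d'} (h : U -> R) (z : T -> U) :
  bounded_meas h -> measurable_fun setT z -> bounded_meas (fun x => h (z x)).
Proof.
move=> [mh [M hM]] mz; split; first exact: measurableT_comp.
by exists M => x.
Qed.

Lemma bounded_meas_ext f g : f =1 g -> bounded_meas f -> bounded_meas g.
Proof. by move=> /funext ->. Qed.

Lemma bounded_meas_sub (G : set (set T)) (f : T -> R) :
  G `<=` measurable ->
  bounded_meas (f : g_sigma_algebraType G -> R) -> bounded_meas f.
Proof.
move=> GM [mf bf]; split => //.
move=> _ B mB; have := mf measurableT B mB; rewrite !setTI.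
move: (f @^-1` B); apply: smallest_sub => //.
exact: sigma_algebra_measurable.
Qed.
End BoundedMeas.

(** * Integrals of bounded functions against a finite measure *)

Section RealIntegral.
Context {R : realType} {d} {T : measurableType d}.
Variable mu : {finite_measure set T -> \bar R}.
Implicit Types f g : T -> R.

Lemma bounded_meas_integrable f : bounded_meas f ->
  mu.-integrable setT (EFin \o f).
Proof.
move=> [mf [M hM]]; apply: measurable_bounded_integrable => //.
  by rewrite -ge0_fin_numE// fin_num_measure.
exists M; split; first exact: num_real.
by move=> y My x _ /=; rewrite (le_trans (hM x))// ltW.
Qed.

Lemma rintD f g : bounded_meas f -> bounded_meas g ->
  rint mu (fun x => f x + g x) = rint mu f + rint mu g.
Proof.
move=> bf bg; exact: (@RintegralD _ _ _ mu setT f g measurableT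
  (bounded_meas_integrable f bf) (bounded_meas_integrable g bg)).
Qed.

Lemma rintB f g : bounded_meas f -> bounded_meas g ->
  rint mu (fun x => f x - g x) = rint mu f - rint mu g.
Proof.
move=> bf bg; exact: (@RintegralB _ _ _ mu setT f g measurableT
  (bounded_meas_integrable f bf) (bounded_meas_integrable g bg)).
Qed.

Lemma rintZ r f : bounded_meas f -> rint mu (fun x => r * f x) = r * rint mu f.
Proof.
move=> bf; exact: (@RintegralZl _ _ _ mu setT f r measurableT
  (bounded_meas_integrable f bf)).
Qed.

Lemma rint_cst r : rint mu (fun _ : T => r) = r * fine (mu setT).
Proof. exact: (@Rintegral_cst _ _ _ mu setT measurableT r). Qed.

Lemma rint_sum {I : Type} (s : seq I) (Q : pred I) (F : I -> T -> R) :
  (forall i, bounded_meas (F i)) ->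
  rint mu (fun x => \sum_(i <- s | Q i) F i x) = \sum_(i <- s | Q i) rint mu (F i).
Proof.
move=> bF; elim: s => [|i s IH].
  under [X in rint mu X]eq_fun do rewrite big_nil.
  by rewrite big_nil rint_cst mul0r.
under [X in rint mu X]eq_fun do rewrite big_cons.
rewrite big_cons -IH; case: (Q i) => //; rewrite rintD//.
exact: bounded_meas_sum.
Qed.

Lemma rint_ge0 f : (forall x, 0 <= f x) -> 0 <= rint mu f.
Proof. by move=> f0; rewrite /rint fine_ge0// integral_ge0// => x _; rewrite lee_fin. Qed.

Lemma le_rint f g : bounded_meas f -> bounded_meas g ->
  (forall x, f x <= g x) -> rint mu f <= rint mu g.
Proof.
move=> bf bg fg; rewrite -subr_ge0 -rintB//; apply: rint_ge0 => x.
by rewrite subr_ge0.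
Qed.

Lemma rint_indic A : measurable A -> rint mu (\1_A : T -> R) = fine (mu A).
Proof. by move=> mA; rewrite /rint integral_indic// setIT. Qed.

Lemma rint_indicE A : measurable A -> mu A = (rint mu (\1_A : T -> R))%:E.
Proof. by move=> mA; rewrite rint_indic// fineK// fin_num_measure. Qed.

Lemma rint_bounded_cvg (F : nat -> T -> R) f M :
  (forall k, measurable_fun setT (F k)) -> measurable_fun setT f ->
  (forall k x, `|F k x| <= M) -> (forall x, F k x @[k --> \oo] --> f x) ->
  rint mu (F k) @[k --> \oo] --> rint mu f.
Proof.
move=> mF mf FM Ff.
have [] := @dominated_convergence _ _ _ mu setT measurableT
    (fun k x => (F k x)%:E) (fun x => (f x)%:E) (fun _ => M%:E).
- by move=> k; exact/measurable_EFinP.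
- exact/measurable_EFinP.
- by apply: aeW => x _; apply: cvg_EFin; [exact: nearW|exact: Ff].
- exact: (bounded_meas_integrable _ (bounded_meas_cst M)).
- by apply: aeW => x k _ /=; rewrite lee_fin.
move=> _ _ h; rewrite /rint; apply: fine_cvg; rewrite fineK//.
apply: integrable_fin_num => //.
apply: bounded_meas_integrable; split => //; exists M => x.
have h1 : `|F k x| @[k --> \oo] --> `|f x| by apply: cvg_norm; exact: Ff.
rewrite -(cvg_lim _ h1)//.
by apply: (limr_le (cvgP _ h1)); apply: nearW.
Qed.
End RealIntegral.

(** * A monotone class theorem for linear functionals *)

Section MonotoneClass.
Context {R : realType} {d} {T : measurableType d}.

Definition bounded_cvg (F : nat -> T -> R) (f : T -> R) : Prop :=
  (forall k, measurable_fun setT (F k)) /\ measurable_fun setT f /\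
  (exists M : R, forall k x, `|F k x| <= M) /\
  (forall x, F k x @[k --> \oo] --> f x).

(* "bc" stands for bounded convergence. *)
Definition bc_functional (Lam : (T -> R) -> R) : Prop :=
  (forall f g, bounded_meas f -> bounded_meas g ->
     Lam (fun x => f x + g x) = Lam f + Lam g) /\
  (forall r f, bounded_meas f -> Lam (fun x => r * f x) = r * Lam f) /\
  (forall F f, bounded_cvg F f -> Lam (F k) @[k --> \oo] --> Lam f).

Lemma bounded_cvg_bounded F f : bounded_cvg F f ->
  (forall k, bounded_meas (F k)) /\ bounded_meas f.
Proof.
move=> [mF [mf [[M hM] Ff]]]; split.
  by move=> k; split => //; exists M.
split => //; exists M => x.
have h1 : `|F k x| @[k --> \oo] --> `|f x| by apply: cvg_norm; exact: Ff.
rewrite -(cvg_lim _ h1)//.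
by apply: (limr_le (cvgP _ h1)); apply: nearW.
Qed.

Variable Lam : (T -> R) -> R.
Hypothesis bLam : bc_functional Lam.

Lemma bcD f g : bounded_meas f -> bounded_meas g ->
  Lam (fun x => f x + g x) = Lam f + Lam g.
Proof. by case: bLam => + _; exact. Qed.

Lemma bcZ r f : bounded_meas f -> Lam (fun x => r * f x) = r * Lam f.
Proof. by case: bLam => _ [+ _]; exact. Qed.

Lemma bcB f g : bounded_meas f -> bounded_meas g ->
  Lam (fun x => f x - g x) = Lam f - Lam g.
Proof.
move=> bf bg; rewrite bcD//; last exact: bounded_measN.
congr (_ + _); rewrite -mulN1r -bcZ//; congr Lam; apply/funext => x.
by rewrite mulN1r.
Qed.

Lemma bc0 : Lam (fun _ => 0) = 0.
Proof.
have := bcZ 0 _ (bounded_meas_cst 0); rewrite [RHS]mul0r => h.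
by rewrite -[RHS]h; congr Lam; apply/funext => x; rewrite mul0r.
Qed.

Lemma bc_sum {I : Type} (s : seq I) (F : I -> T -> R) :
  (forall i, bounded_meas (F i)) ->
  Lam (fun x => \sum_(i <- s) F i x) = \sum_(i <- s) Lam (F i).
Proof.
move=> bF; elim: s => [|i s IH].
  by under [X in Lam X]eq_fun do rewrite big_nil; rewrite big_nil bc0.
under [X in Lam X]eq_fun do rewrite big_cons.
by rewrite big_cons -IH bcD//; exact: bounded_meas_sum.
Qed.

Lemma bc_cvg F f : bounded_cvg F f -> Lam (F k) @[k --> \oo] --> Lam f.
Proof. by case: bLam => _ [_]; exact. Qed.

(** The sets whose indicator is annihilated form a Dynkin system: linearity handles complements,
    bounded convergence handles disjoint unions. In applications [Lam] is signed, being the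
    difference of two laws, so uniqueness takes the form of vanishing. *)
Lemma bc_functional_eq0_set (G : set (set T)) :
  measurable = <<s G >> -> setI_closed G ->
  Lam (fun _ => 1) = 0 -> (forall A, G A -> Lam \1_A = 0) ->
  forall A, measurable A -> Lam \1_A = 0.
Proof.
move=> mG IG L1 LG A; rewrite mG.
apply: (@dynkin_induction _ T G (fun A => Lam \1_A = 0)) => //.
- by rewrite indicT; exact: L1.
- move=> S mS LS; rewrite (_ : \1_(~` S) = (fun x => 1 - \1_S x :> R)).
    rewrite bcB ?L1 ?LS ?subr0//; first exact: bounded_meas_cst.
    exact: bounded_meas_indic.
  by apply/funext => x; rewrite !indicE in_setC; case: (_ \in _);
    rewrite ?subrr ?subr0.
- move=> F mF tF LF.
  have h : Lam (fun x => \sum_(0 <= i < k) \1_(F i) x) @[k --> \oo]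
      --> Lam \1_(\bigcup_k F k).
    apply: bc_cvg; split; first by move=> k; apply: measurable_sum => i;
      exact: measurable_indic.
    split; first by apply: measurable_indic; exact: bigcupT_measurable.
    (* By disjointness the partial sums at a point of the union are 0 up to some index and 1
       afterwards, which gives both the bound 1 and the pointwise limit. *)
    have e x : (\bigcup_k F k) x -> exists i, F i x /\
        forall k, \sum_(0 <= j < k) \1_(F j) x = (i < k)%N%:R :> R.
      move=> [i _ Fi]; exists i; split => // k.
      have e j : \1_(F j) x = (j == i)%:R :> R.
        rewrite indicE; congr (_%:R); case: eqVneq => [->|ji].
          by rewrite mem_set.
        rewrite memNset// => Fj.
        by move: ji; rewrite (tF j i) ?eqxx//; exists x.
      under eq_bigr do rewrite e.
      elim: k => [|k IH]; first by rewrite big_geq.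
      rewrite big_nat_recr//= IH ltnS -natrD; congr (_%:R).
      by case: ltngtP.
    split.
      exists 1 => k x; have [/e[i [_ ->]]|nF] := pselect ((\bigcup_k F k) x).
        by case: ltnP; rewrite ?normr1 ?normr0.
      rewrite big1 ?normr0// => i _; rewrite indicE memNset// => Fi.
      by apply: nF; exists i.
    move=> x; rewrite indicE.
    have [Fx|nF] := pselect ((\bigcup_k F k) x).
      have [i [_ ei]] := e _ Fx; rewrite mem_set//.
      apply: cvg_near_cst; near=> k; rewrite ei (_ : (i < k)%N)//.
      by near: k; exists i.+1.
    rewrite memNset//; apply: cvg_near_cst; apply: nearW => k.
    by rewrite big1// => i _; rewrite indicE memNset// => Fi; apply: nF; exists i.
  have e0 : (fun k => Lam (fun x => \sum_(0 <= i < k) \1_(F i) x)) = cst 0.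
    apply/funext => k; rewrite bc_sum; last by move=> i; exact: bounded_meas_indic.
    by rewrite big1.
  by move: h; rewrite e0 => /cvg_lim <-//; rewrite lim_cst.
Unshelve. all: by end_near. Qed.

(** The sum counts the positive integers at most [n.+1%:R * b]; it is the integer part of that
    product, because [b <= 1] keeps it within [n.+1]. *)
Lemma staircase_approx (b : R) (n : nat) : 0 <= b <= 1 ->
  `|n.+1%:R^-1 * \sum_(k < n.+1) (k.+1%:R <= n.+1%:R * b)%R%:R - b| <= n.+1%:R^-1.
Proof.
move=> /andP[b0 b1]; set m := Num.truncn (n.+1%:R * b).
have nb0 : 0 <= n.+1%:R * b by rewrite mulr_ge0.
have /andP[m1 m2] := truncn_itv nb0; rewrite -/m in m1 m2.
have mn : (m <= n.+1)%N by rewrite -(ler_nat R) (le_trans m1)// ler_piMr.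
have -> : \sum_(k < n.+1) (k.+1%:R <= n.+1%:R * b)%R%:R = m%:R :> R.
  rewrite (eq_bigr (fun k : 'I_n.+1 => (k < m)%N%:R)); last first.
    by move=> k _; congr (_%:R); rewrite -(truncn_ge_nat _ nb0).
  have H p : \sum_(k < p) (k < m)%N%:R = (minn p m)%:R :> R.
    elim: p => [|p IH]; first by rewrite big_ord0 min0n.
    rewrite big_ord_recr/= IH -natrD; congr (_%:R).
    by rewrite /minn; case: (ltnP p m) => h1; case: (ltnP p.+1 m) => h2 /=; lia.
  by rewrite H (minn_idPr mn).
have n0 : 0 < n.+1%:R :> R by rewrite ltr0n.
rewrite -(ler_pM2l n0) -{1}(gtr0_norm n0) -normrM mulrBr mulrA mulfV ?gt_eqF//.
by rewrite mul1r ler_norml; move: m2; rewrite -natr1; lra.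
Qed.

Lemma bc_functional_eq0 (G : set (set T)) :
  measurable = <<s G >> -> setI_closed G ->
  Lam (fun _ => 1) = 0 -> (forall A, G A -> Lam \1_A = 0) ->
  forall b, bounded_meas b -> Lam b = 0.
Proof.
move=> mG IG L1 LG.
have LA := bc_functional_eq0_set _ mG IG L1 LG.
have L01 (b : T -> R) : measurable_fun setT b -> (forall x, 0 <= b x <= 1) -> Lam b = 0.
  move=> mb b01.
  (* The staircase [F n] averages indicators of superlevel sets of [b] and stays uniformly within
     [n.+1%:R^-1] of it. *)
  pose A n k := [set x | k.+1%:R <= n.+1%:R * b x].
  have mA n k : measurable (A n k).
    rewrite -[A n k]setTI; apply: measurable_fun_le => //.
    by apply: measurable_funM.
  pose F n x : R := n.+1%:R^-1 * \sum_(k < n.+1) \1_(A n k) x.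
  have bS n : bounded_meas (fun x => \sum_(k < n.+1) \1_(A n k) x : R).
    by apply: bounded_meas_sum => k; exact: bounded_meas_indic.
  have Fb n x : `|F n x - b x| <= n.+1%:R^-1.
    have := staircase_approx (b x) n (b01 x); rewrite /F.
    congr (`|_ * _ - _| <= _); apply: eq_bigr => k _; rewrite indicE.
    by congr (nat_of_bool _)%:R; apply/idP/idP; rewrite inE.
  have h : Lam (F n) @[n --> \oo] --> Lam b.
    apply: bc_cvg; split.
      move=> n; apply: measurable_funM => //; exact: (bS n).1.
    split => //; split.
      exists 2 => n x; rewrite -(subrK (b x) (F n x)).
      rewrite (le_trans (ler_normD _ _))//.
      rewrite (_ : 2 = 1 + 1)// lerD//; last first.
        by have /andP[b0 b1] := b01 x; rewrite ger0_norm.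
      by rewrite (le_trans (Fb n x))// invf_le1 ?ler1n ?ltr0n.
    move=> x; apply/cvgrPdist_le => e e0; near=> n.
    rewrite distrC (le_trans (Fb n x))//.
    by rewrite ltW//; near: n; exact: (near_infty_natSinv_lt (PosNum e0)).
  have e0 : (fun n => Lam (F n)) = cst 0.
    apply/funext => n; rewrite /F bcZ// bc_sum; last first.
      by move=> k; exact: bounded_meas_indic.
    by rewrite big1 ?mulr0// => k _; exact: LA.
  by move: h; rewrite e0 => /cvg_lim <-//; rewrite lim_cst.
move=> b [mb [M hM]].
(* Affine rescaling to values between 0 and 1; adding 1 makes [K] positive, hence invertible. *)
pose K := `|M| + 1.
have K0 : 0 < K by rewrite ltr_wpDl.
have MK x : `|b x| <= K by rewrite (le_trans (hM x))// /K (le_trans (ler_norm M))// lerDl.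
pose c x := (2 * K)^-1 * (b x + K).
have bc : bounded_meas c.
  apply: bounded_measM; first exact: bounded_meas_cst.
  by apply: bounded_measD; [split=> //; exists M|exact: bounded_meas_cst].
have -> : b = (fun x => 2 * K * c x - K * 1).
  by apply/funext => x; rewrite /c; field; rewrite gt_eqF.
rewrite bcB; [|by apply: bounded_measM => //; exact: bounded_meas_cst|exact: bounded_meas_cst].
rewrite (bcZ (2 * K) c)// (bcZ K (fun _ => 1)); last exact: bounded_meas_cst.
rewrite L1 L01 ?mulr0 ?subr0//; first exact: bc.1.
move=> x; rewrite /c; have := MK x; rewrite ler_norml => /andP[h1 h2].
rewrite mulr_ge0 ?invr_ge0 ?mulr_ge0 ?(ltW K0)//=; last by lra.
by rewrite mulrC ler_pdivrMr ?mulr_gt0//; lra.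
Unshelve. all: by end_near. Qed.
End MonotoneClass.

(** * Integration against a finite kernel *)

Section KernelOperator.
Context {R : realType} {d1 d2} {X : measurableType d1} {Y : measurableType d2}.
Variable K : R.-fker X ~> Y.

(** An alias of [K x] carrying the structure of a finite measure; as it is convertible to [K x], the
    lemmas on [rint mu] apply to [rint (K x)]. *)
Definition fker_at (x : X) : set Y -> \bar R := K x.

HB.instance Definition _ x := Measure.on (fker_at x).

HB.instance Definition _ x :=
  @Measure_isFinite.Build _ _ _ (fker_at x) (finite_kernel_measure K x).

Definition fker_measure (x : X) : {finite_measure set Y -> \bar R} := fker_at x.

(** [C] dominates all total masses of the kernel; its uniformity in [x] keeps a bounded function
    bounded after integration. *)
Lemma rint_fker_bound : exists2 C : R, 0 <= C &
  forall x (g : Y -> R) M, measurable_fun setT g -> (forall y, `|g y| <= M) ->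
  `|rint (K x) g| <= M * C.
Proof.
have [r hr] := measure_uub K.
exists `|r| => // x g M mg gM.
have M0 : 0 <= M by rewrite (le_trans _ (gM point)).
have bg : bounded_meas g by split => //; exists M.
have h1 : rint (fker_measure x) (fun=> M) <= M * `|r|.
  rewrite rint_cst ler_wpM2l//.
  rewrite (le_trans _ (ler_norm r))// -lee_fin fineK ?fin_num_measure//.
  exact/ltW/hr.
have hb : bounded_meas (fun _ : Y => M) by exact: bounded_meas_cst.
have h2 : rint (fker_measure x) g <= rint (fker_measure x) (fun=> M).
  by apply: le_rint => // y; have := gM y; rewrite ler_norml => /andP[].
have h3 : - rint (fker_measure x) (fun=> M) <= rint (fker_measure x) g.
  rewrite -mulN1r -rintZ//; apply: le_rint => //.
    by apply: bounded_measM => //; exact: bounded_meas_cst.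
  by move=> y; have := gM y; rewrite mulN1r ler_norml => /andP[].
by rewrite ler_norml; apply/andP; split; [rewrite (le_trans _ h3)// lerN2|rewrite (le_trans h2)].
Qed.

Lemma bounded_meas_rint_fker (g : X * Y -> R) : bounded_meas g ->
  bounded_meas (fun x => rint (K x) (fun y => g (x, y))).
Proof.
move=> [mg [M gM]]; split; last first.
  have [C _ hC] := rint_fker_bound; exists (M * C) => x.
  by apply: hC => //; exact: measurable_fun_pair2.
have bg x : bounded_meas (fun y => g (x, y)).
  by split; [exact: measurable_fun_pair2|exists M].
have bM : bounded_meas (fun _ : Y => M) by exact: bounded_meas_cst.
(* Measurability in [x] is known for nonnegative integrands: hence the shift by [M], whose integral
   is then subtracted. *)
rewrite (_ : (fun x => _) =
  (fun x => fine (\int[K x]_y (g (x, y) + M)%:E) - fine (\int[K x]_y M%:E))); last first.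
  apply/funext => x.
  have := rintD (fker_measure x) _ _ (bg x) bM; rewrite /rint => ->.
  by rewrite addrK.
have M0 p : 0 <= g p + M.
  by have := gM p; rewrite ler_norml => /andP[]; rewrite -lerBlDr sub0r.
have mf (k : X * Y -> R) : measurable_fun setT k -> (forall p, 0 <= k p) ->
    measurable_fun setT (fun x => fine (\int[K x]_y (k (x, y))%:E)).
  move=> mk k0; apply: (measurableT_comp (fine_measurable _)) => //.
  apply: (measurable_fun_integral_finite_kernel (fun p => (k p)%:E)).
    by move=> p; rewrite lee_fin.
  exact/measurable_EFinP.
apply: measurable_funB.
  by apply: (mf (fun p => g p + M)) => //; exact: measurable_funD.
apply: (mf (fun _ => M)) => // -[x y].
by rewrite (le_trans _ (gM (x, y))).
Qed.

Lemma bounded_meas_fker (h : Y -> R) : bounded_meas h ->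
  bounded_meas (fun x => rint (K x) h).
Proof.
move=> bh; apply: (bounded_meas_rint_fker (fun p => h p.2)).
exact: bounded_meas_comp.
Qed.
End KernelOperator.

Lemma bc_rint {R : realType} {d} {T : measurableType d}
    (mu : {finite_measure set T -> \bar R}) : bc_functional (rint mu).
Proof.
split; first exact: rintD.
split; first by move=> r f; exact: rintZ.
by move=> F f [mF [mf [[M hM] Ff]]]; exact: (@rint_bounded_cvg _ _ _ _ _ _ M).
Qed.

Lemma bc_functional_comp {R : realType} {d1 d2} {X : measurableType d1}
    {Y : measurableType d2} (Lam : (X -> R) -> R) (op : (Y -> R) -> X -> R) :
  bc_functional Lam ->
  (forall f g, bounded_meas f -> bounded_meas g ->
     op (fun y => f y + g y) = (fun x => op f x + op g x)) ->
  (forall r f, bounded_meas f -> op (fun y => r * f y) = (fun x => r * op f x)) ->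
  (forall f, bounded_meas f -> bounded_meas (op f)) ->
  (forall F f, bounded_cvg F f -> bounded_cvg (fun k => op (F k)) (op f)) ->
  bc_functional (fun f => Lam (op f)).
Proof.
move=> bL oD oZ ob oc; split.
  by move=> f g bf bg; rewrite oD// (bcD _ bL)//; exact: ob.
split; first by move=> r f bf; rewrite oZ// (bcZ _ bL)//; exact: ob.
by move=> F f /oc; exact: bc_cvg.
Qed.

Lemma bc_functional_fker {R : realType} {d1 d2} {X : measurableType d1}
    {Y : measurableType d2} (K : R.-fker X ~> Y) (Lam : (X -> R) -> R) :
  bc_functional Lam -> bc_functional (fun g : X * Y -> R =>
     Lam (fun x => rint (K x) (fun y => g (x, y)))).
Proof.
move=> bL.
have sec (g : X * Y -> R) x : bounded_meas g -> bounded_meas (fun y => g (x, y)).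
  by move=> [mg [M gM]]; split; [exact: measurable_fun_pair2|exists M].
apply: (bc_functional_comp _ (fun g x => rint (K x) (fun y => g (x, y))) bL).
- move=> f g bf bg; apply/funext => x.
  by have := rintD (fker_measure K x) _ _ (sec _ x bf) (sec _ x bg).
- move=> r f bf; apply/funext => x.
  by have := rintZ (fker_measure K x) r _ (sec _ x bf).
- by move=> f bf; exact: bounded_meas_rint_fker.
- move=> F f Ff; have [bF bf] := bounded_cvg_bounded _ _ Ff.
  have [mF [mf [[M hM] cF]]] := Ff.
  split; first by move=> k; exact: (bounded_meas_rint_fker K _ (bF k)).1.
  split; first exact: (bounded_meas_rint_fker K _ bf).1.
  split; last first.
    move=> x; apply: (@rint_bounded_cvg _ _ _ (fker_measure K x) _ _ M) => //.
      by move=> k; exact: (sec _ x (bF k)).1.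
    exact: (sec _ x bf).1.
  have [C _ hC] := rint_fker_bound K; exists (M * C) => k x.
  by apply: hC => //; exact: (sec _ x (bF k)).1.
Qed.

(** * Conditionally independent samples *)

Lemma bc_functionalB {R : realType} {d} {T : measurableType d}
    (Lam Lam' : (T -> R) -> R) :
  bc_functional Lam -> bc_functional Lam' ->
  bc_functional (fun f => Lam f - Lam' f).
Proof.
move=> bL bL'; split.
  by move=> f g bf bg; rewrite (bcD _ bL)// (bcD _ bL')//; ring.
split; first by move=> r f bf; rewrite (bcZ _ bL)// (bcZ _ bL')//; ring.
by move=> F f Ff; apply: cvgB; [exact: bc_cvg|exact: bc_cvg].
Qed.

Lemma bc_functional_weighted {R : realType} {d d'} {Om : measurableType d}
    {T : measurableType d'} (mu : {finite_measure set Om -> \bar R})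
    (Z : Om -> R) (phi : Om -> T) :
  bounded_meas Z -> measurable_fun setT phi ->
  bc_functional (fun b : T -> R => rint mu (fun o => Z o * b (phi o))).
Proof.
move=> bZ mphi.
have bb (b : T -> R) : bounded_meas b -> bounded_meas (fun o => Z o * b (phi o)).
  by move=> hb; apply: bounded_measM => //; exact: bounded_meas_comp.
split.
  move=> f g bf bg; rewrite -rintD; [|exact: bb|exact: bb].
  by congr rint; apply/funext => o; rewrite mulrDr.
split.
  move=> r f bf; rewrite -rintZ; last exact: bb.
  by congr rint; apply/funext => o; rewrite mulrCA.
move=> F f Ff; have [bF bf] := bounded_cvg_bounded _ _ Ff.
have [_ [_ [[M FM] cF]]] := Ff; have [mZ [MZ hZ]] := bZ.
apply: (@rint_bounded_cvg _ _ _ mu _ _ (MZ * M)).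
- by move=> k; exact: (bb _ (bF k)).1.
- exact: (bb _ bf).1.
- by move=> k o; rewrite normrM ler_pM.
- by move=> o; apply: cvgMr; exact: cF.
Qed.

(** In weak form, the conditional expectation of [U] given the sigma-algebra generated by [H] is
    zero; the monotone class theorem passes from the pi-system [G] to all test functions [b]. *)
Lemma rint_mul_eq0 {R : realType} {d} {Om : measurableType d}
    (mu : {finite_measure set Om -> \bar R}) (H G : set (set Om)) (U : Om -> R) :
  H `<=` measurable -> <<s H >> = <<s G >> -> setI_closed G ->
  bounded_meas U -> rint mu U = 0 ->
  (forall A, G A -> rint mu (fun o => \1_A o * U o) = 0) ->
  forall b, bounded_meas (b : g_sigma_algebraType H -> R) ->
    rint mu (fun o => b o * U o) = 0.
Proof.
move=> mH HG IG bU U0 UG b bb.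
have mid : measurable_fun setT (id : Om -> g_sigma_algebraType H).
  move=> _ B mB; rewrite setTI preimage_id.
  by move: B mB; apply: smallest_sub => //; exact: sigma_algebra_measurable.
have bc := bc_functional_weighted mu _ _ bU mid.
have := bc_functional_eq0 _ bc G; rewrite -HG => /(_ erefl IG).
under eq_fun do rewrite mulr1.
move=> /(_ U0) h; under eq_fun do rewrite mulrC; apply: h => //.
by move=> A GA; under eq_fun do rewrite mulrC; exact: UG.
Qed.

Lemma sigma_generated_le {T : Type} (G H : set (set T)) :
  G `<=` <<s H >> -> <<s G >> `<=` <<s H >>.
Proof.
by move=> GH; apply: smallest_sub => //; exact: smallest_sigma_algebra.
Qed.

Section OneStep.
Context {R : realType} {dO} {Om : measurableType dO} (P : probability Om R).
Context {d1 d2} {X : measurableType d1} {Y : measurableType d2}.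
Variables (N : nat) (H : set (set Om)).
Variables (x : 'I_N -> Om -> X) (lab : 'I_N -> Om -> 'I_N) (z : 'I_N -> Om -> Y).
Variables (p : 'I_N -> Om -> R) (K : R.-pker X ~> Y).

(** One generation: [x] and [p] are the positions and selection probabilities of the parents, known
    given the past generated by [H]; [lab i] is the parent chosen by the new particle [i], and [z i]
    its position. The abstraction covers both a step of the filter and the initial draw. *)
Definition cond_iid : Prop :=
  H `<=` measurable /\
  (forall j, measurable_fun setT (x j : g_sigma_algebraType H -> X)) /\
  (forall i j, measurable (lab i @^-1` [set j])) /\
  (forall i, measurable_fun setT (z i)) /\
  (forall j, measurable_fun setT (p j : g_sigma_algebraType H -> R)) /\
  (forall j o, 0 <= p j o) /\
  (forall o, \sum_j p j o = 1) /\
  (forall A (J : 'I_N -> 'I_N) (B : 'I_N -> set Y),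
     <<s H >> A -> (forall i, measurable (B i)) ->
     P (A `&` \bigcap_(i in [set: 'I_N]) (lab i @^-1` [set J i] `&` z i @^-1` B i)) =
     (\int[P]_(o in A) \prod_(i < N) ((p (J i) o)%:E * K (x (J i) o) (B i)))%E).

Hypothesis iid : cond_iid.

Local Notation Ex := (rint P).
Local Notation past := (g_sigma_algebraType H).
Local Notation il i j o := ((lab i o == j)%:R : R).
Local Notation Kr B x := (fine (K x B)).

Let mH : H `<=` measurable. Proof. by case: iid. Qed.
Let sHm : <<s H >> `<=` @measurable _ Om.
Proof. by apply: smallest_sub => //; exact: sigma_algebra_measurable. Qed.
Let mx j : measurable_fun setT (x j : past -> X).
Proof. by case: iid => _ [+ _]; exact. Qed.
Let mxO j : measurable_fun setT (x j).
Proof.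
move=> _ B mB; rewrite setTI; apply: sHm.
by have := mx j measurableT B mB; rewrite setTI.
Qed.
Let mlab i j : measurable (lab i @^-1` [set j]).
Proof. by case: iid => _ [_ [+ _]]; exact. Qed.
Let mz i : measurable_fun setT (z i).
Proof. by case: iid => _ [_ [_ [+ _]]]; exact. Qed.
Let p0 j o : 0 <= p j o.
Proof. by case: iid => _ [_ [_ [_ [_ [+ _]]]]]; exact. Qed.
Let p1 o : \sum_j p j o = 1.
Proof. by case: iid => _ [_ [_ [_ [_ [_ [+ _]]]]]]; exact. Qed.
Let ple1 j o : p j o <= 1.
Proof.
rewrite -(p1 o) (bigD1 j)//= lerDl; apply: sumr_ge0 => i _; exact: p0.
Qed.
Let bp j : bounded_meas (p j : past -> R).
Proof.
split; first by case: iid => _ [_ [_ [_ [+ _]]]]; exact.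
by exists 1 => o; rewrite ger0_norm.
Qed.
Let bil i j : bounded_meas (fun o => il i j o).
Proof.
have -> : (fun o => il i j o) = \1_(lab i @^-1` [set j]).
  apply/funext => o; rewrite indicE; congr (nat_of_bool _)%:R.
  by apply/idP/idP; rewrite inE => /eqP.
exact: bounded_meas_indic.
Qed.
Let KrE B y : measurable B -> Kr B y = rint (K y) (fun t => \1_B t).
Proof. by move=> mB; rewrite /rint integral_indic// setIT. Qed.
Let bKr B j : measurable B -> bounded_meas (fun o : past => Kr B (x j o)).
Proof.
move=> mB.
have := bounded_meas_comp _ _ (bounded_meas_fker K _ (bounded_meas_indic B mB)) (mx j).
by apply: bounded_meas_ext => o; rewrite KrE.
Qed.
Let Kfin B y : measurable B -> K y B = (Kr B y)%:E.
Proof. by move=> mB; rewrite fineK//; exact: (finite_kernel_measure K y). Qed.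
Let bz i B : measurable B -> bounded_meas (fun o => \1_B (z i o) : R).
Proof. by move=> mB; apply: bounded_meas_comp => //; exact: bounded_meas_indic. Qed.

Lemma past_bounded_meas (b : Om -> R) :
  bounded_meas (b : past -> R) -> bounded_meas b.
Proof. exact: bounded_meas_sub. Qed.

Let law_indic A (J : 'I_N -> 'I_N) (B : 'I_N -> set Y) :
  <<s H >> A -> (forall i, measurable (B i)) ->
  Ex (fun o => \1_A o * \prod_i (il i (J i) o * \1_(B i) (z i o))) =
  Ex (fun o => \1_A o * \prod_i (p (J i) o * Kr (B i) (x (J i) o))).
Proof.
move=> HA mB.
have mI : measurable (\bigcap_(i in [set: 'I_N]) (lab i @^-1` [set J i] `&` z i @^-1` B i)).
  apply: fin_bigcap_measurable => // i _; apply: measurableI => //.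
  by rewrite -[X in measurable X]setTI; exact: mz.
have mA := sHm _ HA.
have [_ [_ [_ [_ [_ [_ [_ /(_ A J B HA mB) E]]]]]]] := iid.
rewrite /rint; transitivity (fine (P (A `&` \bigcap_(i in [set: 'I_N])
    (lab i @^-1` [set J i] `&` z i @^-1` B i)))); last first.
  rewrite E integral_mkcond; congr fine; apply: eq_integral => o _.
  rewrite patchE; case: ifPn => oA.
    rewrite indicE oA mul1r -prodEFin; apply: eq_bigr => i _.
    by rewrite Kfin.
  by rewrite indicE (negbTE oA) mul0r.
rewrite -rint_indic; last exact: measurableI.
congr rint; apply/funext => o; rewrite indicI/=; congr (_ * _).
rewrite indicE; have [h|h] := pselect ((\bigcap_(i in [set: 'I_N])
    (lab i @^-1` [set J i] `&` z i @^-1` B i)) o).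
  rewrite mem_set// big1// => i _; have [<- Bz] := h i I.
  by rewrite eqxx indicE mem_set// mul1r.
rewrite memNset//.
have [i hi] : exists i, ~ (lab i o = J i /\ B i (z i o)).
  by apply: contrapT => /forallNP hn; apply: h => i _; apply: contrapT; exact: hn.
rewrite (bigD1 i)//=; have [e|] := eqVneq (lab i o) (J i); last by rewrite !mul0r.
by rewrite indicE memNset ?mulr0 ?mul0r// => Bz; apply: hi.
Qed.

Let bil_z i j B : measurable B -> bounded_meas (fun o => il i j o * \1_B (z i o)).
Proof. by move=> mB; apply: bounded_measM => //; exact: bz. Qed.

Let bpK j B : measurable B -> bounded_meas (fun o : past => p j o * Kr B (x j o)).
Proof. by move=> mB; apply: bounded_measM => //; exact: bKr. Qed.

(** The coefficients [c] replace a prescribed label by a weighting of labels, in particular by a set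
    of admissible ones. Expanding the product over all label assignments reduces the claim to
    [law_indic]. *)
Let law_sum A (c : 'I_N -> 'I_N -> R) (B : 'I_N -> set Y) :
  <<s H >> A -> (forall i, measurable (B i)) ->
  Ex (fun o => \1_A o * \prod_i \sum_j c i j * (il i j o * \1_(B i) (z i o))) =
  Ex (fun o => \1_A o * \prod_i \sum_j c i j * (p j o * Kr (B i) (x j o))).
Proof.
move=> HA mB.
have distr (F : 'I_N -> 'I_N -> Om -> R) : (forall i j, bounded_meas (F i j)) ->
  Ex (fun o => \1_A o * \prod_i \sum_j c i j * F i j o) =
  \sum_(f : {ffun 'I_N -> 'I_N}) (\prod_i c i (f i)) *
     Ex (fun o => \1_A o * \prod_i F i (f i) o).
  move=> bF.
  under [in LHS]eq_fun do rewrite (bigA_distr_bigA)/= mulr_sumr.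
  have bP f : bounded_meas (fun o => \1_A o * \prod_i F i (f i) o).
    apply: bounded_measM; first by apply: bounded_meas_indic; exact: sHm.
    by apply: bounded_meas_prod.
  under [in LHS]eq_fun => o do
    under eq_bigr => f _ do rewrite big_split/= mulrCA.
  rewrite rint_sum; last first.
    move=> f; apply: bounded_measM => //; exact: bounded_meas_cst.
  by apply: eq_bigr => f _; rewrite rintZ.
rewrite !distr; last 2 first.
- by move=> i j; apply: past_bounded_meas; exact: bpK.
- by move=> i j; exact: bil_z.
by apply: eq_bigr => f _; rewrite law_indic.
Qed.

(* A pi-system generating the past together with all new particles except the [i]-th;
   [C i = predT] and [B i = setT] leave the [i]-th particle free. *)
Definition others_gen (i : 'I_N) : set (set Om) :=
  [set S | exists A (C : 'I_N -> pred 'I_N) (B : 'I_N -> set Y),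
     [/\ <<s H >> A, (forall k, measurable (B k)), C i = predT, B i = setT &
     S = A `&` \bigcap_(k in [set: 'I_N]) ([set o | C k (lab k o)] `&` z k @^-1` B k)]].

Local Notation others i := (g_sigma_algebraType (others_gen i)).

Lemma others_gen_measurable i : others_gen i `<=` measurable.
Proof.
move=> S [A [C [B [HA mB _ _ ->]]]]; apply: measurableI; first exact: sHm.
apply: fin_bigcap_measurable => // k _; apply: measurableI; last first.
  by rewrite -[X in measurable X]setTI; exact: mz.
rewrite (_ : [set o | _] = \bigcup_(j in [set j | C k j]) (lab k @^-1` [set j])).
  by apply: fin_bigcup_measurable.
apply/seteqP; split => [ o /= Co|o [j /= Cj lj]]; last by rewrite /= lj.

by exists (lab k o).
Qed.

Lemma others_gen_setI i : setI_closed (others_gen i).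
Proof.
move=> S1 S2 [A [C [B [HA mB Ci Bi ->]]]] [A' [C' [B' [HA' mB' Ci' Bi' ->]]]].
exists (A `&` A'), (fun k j => C k j && C' k j), (fun k => B k `&` B' k); split.
- exact: (@measurableI _ past).
- by move=> k; exact: measurableI.
- by rewrite Ci Ci'.
- by rewrite Bi Bi' setIT.
apply/seteqP; split => [ o [[Ao h] [Ao' h']]|o [[Ao Ao'] h]].
  split => // k _; have [/= h1 h2] := h k I; have [/= h3 h4] := h' k I.
  by rewrite h1 h3.
split; split => // k _; have [/= /andP[h1 h3] [h2 h4]] := h k I; by split.
Qed.

Lemma past_others i A : <<s H >> A -> others_gen i A.
Proof.
move=> HA; exists A, (fun _ => predT), (fun _ => setT); split => //.
apply/seteqP; split => [ o Ao|o []//]; by split.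
Qed.

Lemma past_others_bounded_meas i (b : Om -> R) :
  bounded_meas (b : past -> R) -> bounded_meas (b : others i -> R).
Proof.
move=> [mb bb]; split => // _ B mB; apply: sub_sigma_algebra.
by apply: past_others; exact: mb.
Qed.

Lemma others_bounded_meas i (b : Om -> R) :
  bounded_meas (b : others i -> R) -> bounded_meas b.
Proof. by apply: bounded_meas_sub; exact: others_gen_measurable. Qed.

Lemma others_measurable_z i k : k != i ->
  measurable_fun setT (z k : others i -> Y).
Proof.
move=> ki _ B mB; rewrite setTI; apply: sub_sigma_algebra.
exists setT, (fun _ => predT), (fun k' => if k' == k then B else setT); split => //.
- exact: (@measurableT _ past).
- by move=> k'; case: ifP.
- by rewrite eq_sym (negbTE ki).
rewrite setTI; apply/seteqP; split => [ o Bo k' _|o /(_ k I)].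
  by split => //=; case: eqVneq => [->|].
by rewrite eqxx => -[].
Qed.

Lemma others_bounded_lab i k j : k != i ->
  bounded_meas (fun o : others i => il k j o).
Proof.
move=> ki; have -> : (fun o => il k j o) = \1_(lab k @^-1` [set j]).
  apply/funext => o; rewrite indicE; congr (nat_of_bool _)%:R.
  by apply/idP/idP; rewrite inE => /eqP.
apply: bounded_meas_indic; apply: sub_sigma_algebra.
exists setT, (fun k' j' => (k' == k) ==> (j' == j)), (fun _ => setT); split => //.
- exact: (@measurableT _ past).
- by apply/funext => j'; rewrite eq_sym (negbTE ki).
rewrite setTI; apply/seteqP; split => [ o /= <- k' _|o /(_ k I)].
  by split => //=; apply/implyP => /eqP ->.
by rewrite /= eqxx /= => -[/eqP].
Qed.

Let past_gen_id : <<s H >> = <<s <<s H >> >>.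
Proof. by rewrite [RHS]sigma_algebra_id//; exact: smallest_sigma_algebra. Qed.

(** Given the past, particle [i] is independent of the event [Pi] on the others, whose conditional
    probability is [rho]. The joint law yields [rho] times a past-measurable factor, and the law of
    the others alone then trades [rho] for the indicator of [Pi]. *)
Let freeze_indic i j B S : measurable B -> others_gen i S ->
  Ex (fun o => \1_S o * (il i j o * \1_B (z i o))) =
  Ex (fun o => \1_S o * (p j o * Kr B (x j o))).
Proof.
move=> mB [A [C [Bs [HA mBs Ci Bi ->]]]].
pose Pi := \bigcap_(k in [set: 'I_N]) ([set o | C k (lab k o)] `&` z k @^-1` Bs k).
pose rho o := \prod_(k | k != i) \sum_l (C k l)%:R * (p l o * Kr (Bs k) (x l o)).
have mPi : measurable Pi.
  have := others_gen_measurable i Pi; apply.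
  exists setT, C, Bs; split => //; first exact: (@measurableT _ past).
  by rewrite setTI.
have bPi : bounded_meas (\1_Pi : Om -> R) by exact: bounded_meas_indic.
have brho : bounded_meas (rho : past -> R).
  apply: bounded_meas_prod => k; apply: bounded_meas_sum => l.
  by apply: bounded_measM; [exact: bounded_meas_cst|exact: bpK].
have PiE o : \1_Pi o = \prod_(k | k != i)
    \sum_l (C k l)%:R * (il k l o * \1_(Bs k) (z k o)).
  have lE k : \sum_l (C k l)%:R * (il k l o * \1_(Bs k) (z k o)) =
      (C k (lab k o))%:R * \1_(Bs k) (z k o).
    rewrite (bigD1 (lab k o))//= eqxx mul1r big1 ?addr0// => l.
    by rewrite eq_sym => /negbTE ->; rewrite mul0r mulr0.
  under eq_bigr do rewrite lE.
  rewrite indicE; have [h|h] := pselect (Pi o).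
    rewrite mem_set// big1// => k _; have [/= -> Bz] := h k I.
    by rewrite indicE mem_set// mul1r.
  rewrite memNset//.
  have [k hk] : exists k, ~ (C k (lab k o) /\ Bs k (z k o)).
    by apply: contrapT => /forallNP hn; apply: h => k _; apply: contrapT; exact: hn.
  have ki : k != i by apply/eqP => e; apply: hk; rewrite e Ci Bi.
  rewrite (bigD1 k)//=; case: (boolP (C k (lab k o))) => [Ck|]; last by rewrite !mul0r.
  by rewrite indicE memNset ?mulr0 ?mul0r// => Bz; apply: hk.
(* Particle [i] is left free here, so its factor is 1 on both sides: on the right because the [p l]
   sum to 1. *)
have marg A' : <<s H >> A' -> Ex (fun o => \1_A' o * \1_Pi o) = Ex (fun o => \1_A' o * rho o).
  move=> HA'; have := law_sum A' (fun k l => (C k l)%:R) Bs HA' mBs.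
  set f := (f in Ex f = _ -> _); set g := (g in _ = Ex g -> _).
  have -> : f = (fun o => \1_A' o * \1_Pi o).
    apply/funext => o; rewrite /f; congr (_ * _); rewrite PiE (bigD1 i)//= Ci Bi.
    rewrite indicT/= (_ : \sum_j _ = 1) ?mul1r// (bigD1 (lab i o))//= eqxx !mul1r.
    rewrite big1 ?addr0// => l; rewrite eq_sym => /negbTE ->.
    by rewrite mul0r mulr0.
  have -> // : g = (fun o => \1_A' o * rho o).
  apply/funext => o; rewrite /g; congr (_ * _); rewrite (bigD1 i)//= Ci Bi.
  rewrite [X in X * _](_ : _ = \sum_l p l o); first by rewrite p1 mul1r.
  apply: eq_bigr => l _.
  by rewrite /= mul1r prob_kernel mulr1.
have margb b : bounded_meas (b : past -> R) ->
    Ex (fun o => b o * \1_Pi o) = Ex (fun o => b o * rho o).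
  move=> bb; have bbO := past_bounded_meas _ bb; have brO := past_bounded_meas _ brho.
  have H1 A' : <<s H >> A' -> Ex (fun o => \1_A' o * (\1_Pi o - rho o)) = 0.
    move=> HA'; have bA : bounded_meas (\1_A' : Om -> R).
      by apply: bounded_meas_indic; exact: sHm.
    under eq_fun do rewrite mulrBr.
    by rewrite rintB ?marg ?subrr//; exact: bounded_measM.
  have U0 : Ex (fun o => \1_Pi o - rho o) = 0.
    have := H1 setT (@measurableT _ past).
    by under eq_fun do rewrite indicT mul1r.
  have := rint_mul_eq0 P H <<s H >> (fun o => \1_Pi o - rho o) mH past_gen_id
    (@measurableI _ past) (bounded_measB _ _ bPi brO) U0 H1 b bb.
  under eq_fun do rewrite mulrBr.
  rewrite rintB; [|exact: bounded_measM|exact: bounded_measM].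
  by move/eqP; rewrite subr_eq0 => /eqP.
(* Particle [i] is pinned to the label [j], every other [k] to the labels allowed by [C k]. *)
pose c k l : R := if k == i then (l == j)%:R else (C k l)%:R.
have mB' k : measurable (if k == i then B else Bs k) by case: ifP.
have := law_sum A c (fun k => if k == i then B else Bs k) HA mB'.
set f := (f in Ex f = _ -> _); set g := (g in _ = Ex g -> _).
have -> : f = (fun o => \1_(A `&` Pi) o * (il i j o * \1_B (z i o))).
  apply/funext => o; rewrite /f indicI/= -mulrA; congr (_ * _).
  rewrite (bigD1 i)//= PiE mulrC /c eqxx; congr (_ * _).
    by apply: eq_bigr => k /negbTE ->.
  rewrite (bigD1 j)//= eqxx mul1r big1 ?addr0// => l /negbTE ->.
  by rewrite mul0r.
have -> : g = (fun o => (\1_A o * (p j o * Kr B (x j o))) * rho o).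
  apply/funext => o; rewrite /g -mulrA; congr (_ * _).
  rewrite (bigD1 i)//= /c eqxx; congr (_ * _).
    rewrite (bigD1 j)//= eqxx mul1r big1 ?addr0// => l /negbTE ->.
    by rewrite mul0r.
  by apply: eq_bigr => k /negbTE ->.
move=> ->; rewrite -margb; last first.
  by apply: bounded_measM; [exact: bounded_meas_indic|exact: bpK].
by congr rint; apply/funext => o; rewrite indicI/= mulrAC.
Qed.

Local Notation Kop g := (fun y => rint (K y) (fun t => g (y, t))).

(* Step from rectangles to bounded functions: first [Z] varies for fixed [B], then the
   indicator of [D1] is absorbed into [Z] and [g] varies. *)
Lemma freeze i j (Z : Om -> R) (g : X * Y -> R) :
  bounded_meas (Z : others i -> R) -> bounded_meas g ->
  Ex (fun o => Z o * (il i j o * g (x j o, z i o))) =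
  Ex (fun o => Z o * (p j o * Kop g (x j o))).
Proof.
move=> bZ bg.
have fB B Z' : measurable B -> bounded_meas (Z' : others i -> R) ->
    Ex (fun o => Z' o * (il i j o * \1_B (z i o))) =
    Ex (fun o => Z' o * (p j o * Kr B (x j o))).
  move=> mB bZ'.
  have b1 : bounded_meas (fun o => il i j o * \1_B (z i o)) by exact: bil_z.
  have b2 : bounded_meas (fun o => p j o * Kr B (x j o)).
    by apply: past_bounded_meas; exact: bpK.
  have bO := others_bounded_meas _ _ bZ'.
  have H1 S : others_gen i S -> Ex (fun o => \1_S o *
      (il i j o * \1_B (z i o) - p j o * Kr B (x j o))) = 0.
    move=> GS; have bS : bounded_meas (\1_S : Om -> R).
      by apply: bounded_meas_indic; exact: others_gen_measurable GS.
    under eq_fun do rewrite mulrBr.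
    by rewrite rintB ?freeze_indic ?subrr//; exact: bounded_measM.
  have U0 : Ex (fun o => il i j o * \1_B (z i o) - p j o * Kr B (x j o)) = 0.
    have := H1 setT (past_others i setT (@measurableT _ past)).
    by under eq_fun do rewrite indicT mul1r.
  have := rint_mul_eq0 P _ (others_gen i) _ (others_gen_measurable i) erefl
    (others_gen_setI i) (bounded_measB _ _ b1 b2) U0 H1 Z' bZ'.
  under eq_fun do rewrite mulrBr.
  rewrite rintB; [|exact: bounded_measM|exact: bounded_measM].
  by move/eqP; rewrite subr_eq0 => /eqP.
have bZO := others_bounded_meas _ _ bZ.
have bpO := past_bounded_meas _ (bp j).
pose L1 (g : X * Y -> R) := Ex (fun o => (Z o * il i j o) * g (x j o, z i o)).
pose L2 (g : X * Y -> R) := Ex (fun o => (Z o * p j o) * Kop g (x j o)).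
have bc : bc_functional (fun g => L1 g - L2 g).
  apply: bc_functionalB.
    apply: (bc_functional_weighted P _ (fun o => (x j o, z i o))).
      exact: bounded_measM.
    exact: measurable_fun_pair.
  apply: (bc_functional_fker K (fun f => Ex (fun o => (Z o * p j o) * f (x j o)))).
  by apply: bc_functional_weighted => //; exact: bounded_measM.
have L12 D1 D2 : measurable D1 -> measurable D2 ->
    L1 \1_(D1 `*` D2) - L2 \1_(D1 `*` D2) = 0.
  move=> mD1 mD2; apply/eqP; rewrite subr_eq0; apply/eqP.
  have iX a b : \1_(D1 `*` D2) (a, b) = \1_D1 a * \1_D2 b :> R.
    by rewrite !indicE in_setX/=; do 2 case: (_ \in _); rewrite ?mulr1 ?mulr0.
  have := fB D2 (fun o => Z o * \1_D1 (x j o)) mD2.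
  rewrite /L1 /L2 => h.
  transitivity (Ex (fun o => Z o * \1_D1 (x j o) * (il i j o * \1_D2 (z i o)))).
    by congr rint; apply/funext => o; rewrite iX; ring.
  rewrite h; last first.
    apply: bounded_measM => //; apply: past_others_bounded_meas.
    by apply: bounded_meas_comp => //; exact: bounded_meas_indic.
  congr rint; apply/funext => o.
  rewrite (_ : rint _ _ = \1_D1 (x j o) * Kr D2 (x j o)); first by ring.
  rewrite KrE// -(rintZ (fker_measure K (x j o)))//; last exact: bounded_meas_indic.
  by congr rint; apply/funext => t; rewrite iX.
have := bc_functional_eq0 _ bc _ (measurable_prod_measurableType X Y).
move=> /(_ _ _ _ g bg) h.
transitivity (L1 g); first by congr rint; apply/funext => o; rewrite mulrA.
transitivity (L2 g); last by congr rint; apply/funext => o; rewrite mulrA.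
apply/eqP; rewrite -subr_eq0; apply/eqP/h.
- move=> _ _ [A mA [B mB <-]] [A' mA' [B' mB' <-]].
  exists (A `&` A'); first exact: measurableI.
  by exists (B `&` B'); [exact: measurableI|rewrite setXI].
- by have := L12 setT setT measurableT measurableT; rewrite setXTT indicT.
- by move=> _ [A mA [B mB <-]]; exact: L12.
Qed.

(** Up to squares, three weights [D] of the parent occur: the constant 1, the indicator that the
    parent lies in a given cluster, and the conditional mean attached to the cluster of the parent.
    All are past-measurable. *)
Definition stat (D : 'I_N -> Om -> R) (g : X * Y -> R) (t : 'I_N) (o : Om) : R :=
  D (lab t o) o * g (x (lab t o) o, z t o).

Definition cmean (D : 'I_N -> Om -> R) (g : X * Y -> R) (o : Om) : R :=
  \sum_j p j o * (D j o * Kop g (x j o)).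

Definition psum (F : 'I_N -> Om -> R) (t : nat) (o : Om) : R :=
  \sum_(i < N | (i < t)%N) F i o.

Let statE D g t o :
  stat D g t o = \sum_j D j o * (il t j o * g (x j o, z t o)).
Proof.
rewrite /stat (bigD1 (lab t o))//= eqxx mul1r big1 ?addr0// => j.
by rewrite eq_sym => /negbTE ->; rewrite mul0r mulr0.
Qed.

Lemma stat_sqr D g t o : stat D g t o ^+ 2 =
  stat (fun j o => D j o ^+ 2) (fun q => g q ^+ 2) t o.
Proof. by rewrite /stat exprMn. Qed.

Lemma psumS F (t : 'I_N) o : psum F t.+1 o = psum F t o + F t o.
Proof.
rewrite /psum (bigD1 t)//= addrC; congr (_ + _); apply: eq_bigl => i.
by rewrite ltnS ltn_neqAle andbC.
Qed.

Let psumE (F : 'I_N -> Om -> R) t :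
  psum F t = (fun o => \sum_(i < N) (if (i < t)%N then F i o else 0)).
Proof. by apply/funext => o; rewrite /psum big_mkcond. Qed.

Lemma psum0 F o : psum F 0 o = 0.
Proof. by rewrite /psum big1. Qed.

Lemma psum_full F o : psum F N o = \sum_i F i o.
Proof. by rewrite /psum; apply: eq_bigl => i; rewrite ltn_ord. Qed.

Section Statistics.
Variables (D : 'I_N -> Om -> R) (g : X * Y -> R).
Hypotheses (bD : forall j, bounded_meas (D j : past -> R)) (bg : bounded_meas g).

Lemma bounded_cmean : bounded_meas (cmean D g : past -> R).
Proof.
apply: bounded_meas_sum => j; apply: bounded_measM => //.
apply: bounded_measM => //.
exact: (bounded_meas_comp _ _ (bounded_meas_rint_fker K g bg) (mx j)).
Qed.

Lemma bounded_stat t : bounded_meas (stat D g t).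
Proof.
apply: (bounded_meas_ext _ _ (fun o => esym (statE D g t o))).
apply: bounded_meas_sum => j; apply: bounded_measM; first exact: past_bounded_meas.
apply: bounded_measM => //; apply: (bounded_meas_comp g (fun o => (x j o, z t o))) => //.
exact: measurable_fun_pair.
Qed.

Lemma others_bounded_stat i t : t != i -> bounded_meas (stat D g t : others i -> R).
Proof.
move=> ti; rewrite (funext (statE D g t)).
apply: bounded_meas_sum => j; apply: bounded_measM.
  exact: past_others_bounded_meas.
apply: bounded_measM; first exact: others_bounded_lab.
have mxz : measurable_fun setT (fun o : others i => (x j o, z t o)).
  apply: measurable_fun_pair; last exact: others_measurable_z.
  move=> _ B mB; rewrite setTI; apply: sub_sigma_algebra; apply: past_others.
  by have := mx j measurableT B mB; rewrite setTI.
exact: (bounded_meas_comp _ _ bg mxz).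
Qed.

(** [cmean D g] is the conditional mean of [stat D g t] even when the other new particles are given.
    Splitting over the value of [lab t] reduces this to [freeze], the weight [D j] being absorbed
    into [Z]. *)
Lemma stat_mean t Z : bounded_meas (Z : others t -> R) ->
  Ex (fun o => Z o * stat D g t o) = Ex (fun o => Z o * cmean D g o).
Proof.
move=> bZ; have bZO := others_bounded_meas _ _ bZ.
have bDO j : bounded_meas (D j) by exact: past_bounded_meas.
have bpO j : bounded_meas (p j) by exact: past_bounded_meas.
under [in LHS]eq_fun do rewrite statE mulr_sumr.
under [in RHS]eq_fun do rewrite mulr_sumr.
rewrite !rint_sum; last 2 first.
- move=> j; do 2 (apply: bounded_measM => //); apply: bounded_measM => //.
  exact: (bounded_meas_comp _ _ (bounded_meas_rint_fker K g bg) (mxO j)).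
- move=> j; do 2 (apply: bounded_measM => //); apply: bounded_measM => //.
  apply: (bounded_meas_comp g (fun o => (x j o, z t o))) => //.
  exact: measurable_fun_pair.
apply: eq_bigr => j _.
have := freeze t j (fun o => Z o * D j o) g.
have b1 : bounded_meas (fun o : others t => Z o * D j o).
  by apply: bounded_measM => //; exact: past_others_bounded_meas.
move=> /(_ b1 bg) h.
transitivity (Ex (fun o => Z o * D j o * (il t j o * g (x j o, z t o)))).
  by congr rint; apply/funext => o; rewrite mulrA.
by rewrite h; congr rint; apply/funext => o; ring.
Qed.
End Statistics.

(** When the square of a partial sum is expanded, the cross term with the next increment vanishes,
    because [c] times the earlier sum is an admissible test function for that increment. *)
Lemma orthogonal_increments_moment (c : Om -> R) (Del : 'I_N -> Om -> R) (v : R) :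
  bounded_meas (c : past -> R) ->
  (forall i t : 'I_N, (i < t)%N -> bounded_meas (Del i : others t -> R)) ->
  (forall t, bounded_meas (Del t)) ->
  (forall t Z, bounded_meas (Z : others t -> R) -> Ex (fun o => Z o * Del t o) = 0) ->
  (forall t, Ex (fun o => c o * Del t o ^+ 2) <= v) ->
  forall t, (t <= N)%N -> Ex (fun o => c o * psum Del t o ^+ 2) <= t%:R * v.
Proof.
move=> bc bDt bDel ortho hv; elim=> [_|t IH tN].
  under eq_fun do rewrite psum0 expr0n/= mulr0.
  by rewrite rint_cst !mul0r.
pose T := Ordinal tN.
have bcO := past_bounded_meas _ bc.
have bS : bounded_meas (psum Del t : others T -> R).
  rewrite psumE.
  apply: bounded_meas_sum => i; case: (boolP (i < _)%N) => it; first exact: bDt.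
  exact: bounded_meas_cst.
have bSO := others_bounded_meas _ _ bS.
have -> : (fun o => c o * psum Del t.+1 o ^+ 2) = (fun o => c o * psum Del t o ^+ 2 +
    (2 * ((c o * psum Del t o) * Del T o) + c o * Del T o ^+ 2)).
  by apply/funext => o; rewrite (psumS _ T); ring.
have b1 : bounded_meas (fun o => c o * psum Del t o ^+ 2).
  by apply: bounded_measM => //; exact: bounded_measX.
have b2 : bounded_meas (fun o => (c o * psum Del t o) * Del T o).
  by do 2 (apply: bounded_measM => //).
have b3 : bounded_meas (fun o => c o * Del T o ^+ 2).
  by apply: bounded_measM => //; exact: bounded_measX.
have b4 : bounded_meas (fun o => 2 * ((c o * psum Del t o) * Del T o)).
  by apply: bounded_measM => //; exact: bounded_meas_cst.
rewrite rintD//; last exact: bounded_measD.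
rewrite rintD// rintZ// ortho; last first.
  by apply: bounded_measM => //; exact: past_others_bounded_meas.
rewrite mulr0 add0r -natr1 mulrDl mul1r lerD//.
exact/IH/ltnW.
Qed.

(** A conditional variance is at most the conditional second moment; the gap is the weighted mean
    square of [m]. *)
Lemma centered_moment (c U m : Om -> R) t :
  bounded_meas (c : others t -> R) -> (forall o, 0 <= c o) ->
  bounded_meas U -> bounded_meas (m : others t -> R) ->
  (forall Z, bounded_meas (Z : others t -> R) ->
     Ex (fun o => Z o * U o) = Ex (fun o => Z o * m o)) ->
  Ex (fun o => c o * (U o - m o) ^+ 2) <= Ex (fun o => c o * U o ^+ 2).
Proof.
move=> bc c0 bU bm Um.
have bcO := others_bounded_meas _ _ bc; have bmO := others_bounded_meas _ _ bm.
have b1 : bounded_meas (fun o => c o * U o ^+ 2).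
  by apply: bounded_measM => //; exact: bounded_measX.
have b2 : bounded_meas (fun o => c o * m o * U o).
  by do 2 (apply: bounded_measM => //).
have b3 : bounded_meas (fun o => c o * m o * m o).
  by do 2 (apply: bounded_measM => //).
have -> : (fun o => c o * (U o - m o) ^+ 2) = (fun o => c o * U o ^+ 2 -
    (2 * (c o * m o * U o) - c o * m o * m o)).
  by apply/funext => o; ring.
have b4 : bounded_meas (fun o => 2 * (c o * m o * U o)).
  by apply: bounded_measM => //; exact: bounded_meas_cst.
rewrite rintB//; last exact: bounded_measB.
rewrite rintB// rintZ// Um; last exact: bounded_measM.
rewrite lerBlDr lerDl mulr2n mulrDl mul1r addrK; apply: rint_ge0 => o.
by rewrite -mulrA mulr_ge0// -expr2 sqr_ge0.
Qed.

Lemma lln_moment (c : Om -> R) D g (t : nat) :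
  bounded_meas (c : past -> R) -> (forall o, 0 <= c o) ->
  (forall j, bounded_meas (D j : past -> R)) ->
  bounded_meas g -> (t <= N)%N ->
  Ex (fun o => c o * psum (fun i o => stat D g i o - cmean D g o) t o ^+ 2) <=
  t%:R * Ex (fun o => c o * cmean (fun j o => D j o ^+ 2) (fun q => g q ^+ 2) o).
Proof.
move=> bc c0 bD bg tN.
have bm := bounded_cmean D g bD bg; have bmO := past_bounded_meas _ bm.
have bs := bounded_stat D g bD bg.
apply: orthogonal_increments_moment => //.
- move=> i k ik; apply: bounded_measB; last exact: past_others_bounded_meas.
  apply: others_bounded_stat => //; apply/eqP => e.
  by move: ik; rewrite e ltnn.
- by move=> k; exact: bounded_measB.
- move=> k Z bZ; have bZO := others_bounded_meas _ _ bZ.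
  under eq_fun do rewrite mulrBr.
  by rewrite rintB ?stat_mean ?subrr//; exact: bounded_measM.
- move=> k; apply: (le_trans (centered_moment c _ _ k _ _ _ _ _)) => //.
  + exact: past_others_bounded_meas.
  + exact: past_others_bounded_meas.
  + by move=> Z bZ; exact: stat_mean.
  under eq_fun do rewrite stat_sqr.
  have bD2 j : bounded_meas (fun o : past => D j o ^+ 2) by exact: bounded_measX.
  rewrite (stat_mean _ _ bD2 (bounded_measX _ 2 bg))//.
  exact: past_others_bounded_meas.
Qed.

(** * Second moments of the sum of squared cluster sums *)

Section Moments.
Variables (c : Om -> R) (E : 'I_N -> Om -> 'I_N) (g : X * Y -> R).
Hypotheses (bc : bounded_meas (c : past -> R)) (c0 : forall o, 0 <= c o)
  (bE : forall e j, bounded_meas (fun o : past => (E j o == e)%:R : R))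
  (bg : bounded_meas g).

Local Notation d e := (fun (j : 'I_N) (o : Om) => (E j o == e)%:R : R).
Local Notation mu e := (cmean (d e) g).
Local Notation s2 e := (cmean (d e) (fun q => g q ^+ 2)).
Local Notation cent e := (fun i o => stat (d e) g i o - mu e o).

(** Summing over [t] collects each pair of distinct particles once, that is, half of the
    off-diagonal part of the sum over [e] of the squared centred cluster sums. *)
Definition degenerate_incr (t : 'I_N) (o : Om) : R :=
  \sum_e psum (cent e) t o * (stat (d e) g t o - mu e o).

Let dsqr e : (fun j o => (d e) j o ^+ 2) = d e.
Proof. by apply/funext => j; apply/funext => o; case: eqP; rewrite ?expr1n ?expr0n. Qed.

Let bmu e : bounded_meas (mu e : past -> R).
Proof. exact: bounded_cmean. Qed.

Let bcent e (i k : 'I_N) : (i < k)%N -> bounded_meas (cent e i : others k -> R).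
Proof.
move=> ik; apply: bounded_measB; last exact: past_others_bounded_meas.
by apply: others_bounded_stat => //; apply/eqP => eik; move: ik; rewrite eik ltnn.
Qed.

Let bpsum (F : 'I_N -> Om -> R) (k k' : 'I_N) : (k <= k')%N ->
  (forall i : 'I_N, (i < k')%N -> bounded_meas (F i : others k' -> R)) ->
  bounded_meas (psum F k : others k' -> R).
Proof.
move=> kk' bF; rewrite psumE.
apply: bounded_meas_sum => i; case: (boolP (i < _)%N) => it; last exact: bounded_meas_cst.
by apply: bF; exact: leq_trans it kk'.
Qed.

Let bpsumO e (k : 'I_N) : bounded_meas (psum (cent e) k).
Proof.
by apply: (others_bounded_meas k); apply: bpsum => // i ik; exact: bcent.
Qed.

(** The square of particle [t] is replaced by its conditional mean [s2 e], and the centred partial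
    sum of cluster [e] has second moment at most [t] times a second [s2 e]. One factor [N] counts
    the increments, the other the terms of a partial sum. *)
Lemma degenerate_moment :
  Ex (fun o => c o * psum degenerate_incr N o ^+ 2) <=
  N%:R * (N%:R * Ex (fun o => c o * \sum_e s2 e o ^+ 2)).
Proof.
have bcO := past_bounded_meas _ bc.
have bmuO e := past_bounded_meas _ (bmu e).
have bst e t : bounded_meas (stat (d e) g t) by exact: bounded_stat.
have bg2 : bounded_meas (fun q => g q ^+ 2) by exact: bounded_measX.
have bs2 e : bounded_meas (s2 e : past -> R) by exact: bounded_cmean.
have bs2O e := past_bounded_meas _ (bs2 e).
have s20 e o : 0 <= s2 e o.
  apply: sumr_ge0 => j _; rewrite mulr_ge0// mulr_ge0//.
  by apply: (rint_ge0 (fker_measure K (x j o))) => y; exact: sqr_ge0.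
apply: orthogonal_increments_moment => //.
- move=> i t it; apply: bounded_meas_sum => e; apply: bounded_measM; last exact: bcent.
  by apply: bpsum; [exact: ltnW|move=> *; exact: bcent].
- move=> t; apply: bounded_meas_sum => e; apply: bounded_measM => //.
  exact: bounded_measB.
- move=> t Z bZ; have bZO := others_bounded_meas _ _ bZ.
  under eq_fun do rewrite mulr_sumr.
  rewrite rint_sum; last first.
    move=> e; do 2 (apply: bounded_measM => //); exact: bounded_measB.
  rewrite big1// => e _.
  under eq_fun do rewrite mulrA mulrBr.
  have bp' : bounded_meas (psum (cent e) t : others t -> R).
    by apply: bpsum => // i it; exact: bcent.
  have b1 : bounded_meas (fun o : others t => Z o * psum (cent e) t o).
    exact: bounded_measM.
  have b1O := others_bounded_meas _ _ b1.
  rewrite rintB; [|exact: bounded_measM|exact: bounded_measM].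
  by rewrite stat_mean ?subrr.
move=> t.
have bp' e : bounded_meas (psum (cent e) t : others t -> R).
  by apply: bpsum => // i it; exact: bcent.
pose U o := \sum_e psum (cent e) t o * stat (d e) g t o.
pose m o := \sum_e psum (cent e) t o * mu e o.
have bU : bounded_meas U.
  by apply: bounded_meas_sum => e; exact: bounded_measM.
have bm : bounded_meas (m : others t -> R).
  apply: bounded_meas_sum => e; apply: bounded_measM => //.
  exact: past_others_bounded_meas.
have -> : (fun o => c o * degenerate_incr t o ^+ 2) = (fun o => c o * (U o - m o) ^+ 2).
  apply/funext => o; congr (_ * _ ^+ 2); rewrite /U /m -sumrB.
  by apply: eq_bigr => e _; rewrite mulrBr.
apply: (le_trans (centered_moment c _ _ t _ _ _ _ _)) => //.
- exact: past_others_bounded_meas.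
- move=> Z bZ; have bZO := others_bounded_meas _ _ bZ.
  rewrite /U /m; under [in LHS]eq_fun do rewrite mulr_sumr.
  under [in RHS]eq_fun do rewrite mulr_sumr.
  rewrite !rint_sum; last 2 first.
  + by move=> e; do 2 (apply: bounded_measM => //).
  + by move=> e; do 2 (apply: bounded_measM => //).
  apply: eq_bigr => e _.
  under [in LHS]eq_fun do rewrite mulrA; under [in RHS]eq_fun do rewrite mulrA.
  by rewrite stat_mean//; exact: bounded_measM.
(* The parent of particle [t] lies in one cluster only, so squaring the sum over [e] leaves no cross
   terms. *)
have -> : (fun o => c o * U o ^+ 2) = (fun o => \sum_e
    (c o * psum (cent e) t o ^+ 2) * stat (d e) (fun q => g q ^+ 2) t o).
  apply/funext => o; set e0 := E (lab t o) o.
  have st0 e f : e != e0 -> stat (d e) f t o = 0.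
    by move=> ne; rewrite /stat -/e0 eq_sym (negbTE ne) mul0r.
  have -> : U o = psum (cent e0) t o * stat (d e0) g t o.
    by rewrite /U (bigD1 e0)//= big1 ?addr0// => e ne; rewrite st0 ?mulr0.
  rewrite (bigD1 e0)//= big1 ?addr0 => [|e ne]; last by rewrite st0 ?mulr0.
  by rewrite exprMn stat_sqr dsqr mulrA.
rewrite rint_sum; last first.
  move=> e; apply: bounded_measM; last by exact: bounded_stat.
  by apply: bounded_measM => //; exact: bounded_measX.
under [in leRHS]eq_fun do rewrite mulr_sumr.
rewrite [in leRHS]rint_sum; last first.
  by move=> e; apply: bounded_measM => //; exact: bounded_measX.
rewrite mulr_sumr; apply: ler_sum => e _.
rewrite stat_mean//; last first.
  apply: bounded_measM; last exact: bounded_measX.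
  exact: past_others_bounded_meas.
have -> : (fun o => c o * psum (cent e) t o ^+ 2 * s2 e o) =
  (fun o => (c o * s2 e o) * psum (cent e) t o ^+ 2).
  by apply/funext => o; rewrite mulrAC.
have tN : (t <= N)%N by exact/ltnW/ltn_ord.
have bcs : bounded_meas (fun o : past => c o * s2 e o) by exact: bounded_measM.
have cs0 o : 0 <= c o * s2 e o by rewrite mulr_ge0.
(* The weight is now [c * s2 e], again past-measurable and nonnegative; this produces the square of
   [s2 e]. *)
have := @lln_moment _ (d e) g t bcs cs0 (bE e) bg tN.
rewrite dsqr => /le_trans; apply.
under eq_fun do rewrite -mulrA -expr2.
rewrite ler_wpM2r ?ler_nat//; apply: rint_ge0 => o.
by rewrite mulr_ge0// sqr_ge0.
Qed.

Local Notation v o := (\sum_e mu e o ^+ 2).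
Local Notation one := (fun (_ : 'I_N) (_ : Om) => 1 : R).
Local Notation dB := (fun (j : 'I_N) (o : Om) => mu (E j o) o).
Local Notation sqr_stat := (stat one (fun q => g q ^+ 2)).

(* Hoeffding decomposition; [v] is the off-diagonal conditional mean and
   [stat dB g - v] the projection on a single particle. *)
Lemma cluster_decomposition o :
  \sum_e (\sum_t stat (d e) g t o) ^+ 2 =
  2 * psum degenerate_incr N o
  + \sum_t sqr_stat t o
  + (2 * N%:R - 2) * \sum_t (stat dB g t o - v o)
  + (N%:R ^+ 2 - N%:R) * v o.
Proof.
have cent_sqr t : \sum_e cent e t o ^+ 2 = sqr_stat t o - 2 * stat dB g t o + v o.
  set e0 := E (lab t o) o.
  have st0 e : e != e0 -> stat (d e) g t o = 0.
    by move=> ne; rewrite /stat -/e0 eq_sym (negbTE ne) mul0r.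
  have -> : sqr_stat t o = \sum_e stat (d e) g t o ^+ 2.
    rewrite (bigD1 e0)//= big1 ?addr0; last by move=> e ne; rewrite st0 ?expr0n.
    by rewrite /stat -/e0 eqxx !mul1r.
  have -> : stat dB g t o = \sum_e mu e o * stat (d e) g t o.
    rewrite (bigD1 e0)//= big1 ?addr0; last by move=> e ne; rewrite st0 ?mulr0.
    by rewrite /stat -/e0 eqxx !mul1r.
  rewrite mulr_sumr -sumrB -big_split/=; apply: eq_bigr => e _; ring.
(* Each new particle adds its own square and twice its product with the earlier sum; the latter
   products are collected by [degenerate_incr]. *)
have sqr_sum t : (t <= N)%N -> \sum_e psum (cent e) t o ^+ 2 =
    2 * psum degenerate_incr t o + psum (fun i o => \sum_e cent e i o ^+ 2) t o.
  elim: t => [_|t IH tN].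
    rewrite !psum0 big1 ?mulr0 ?addr0// => e _; by rewrite psum0 expr0n.
  rewrite !(psumS _ (Ordinal tN)) mulrDr addrACA -IH; last exact: ltnW.
  rewrite /degenerate_incr mulr_sumr -!big_split/=; apply: eq_bigr => e _.
  by rewrite (psumS _ (Ordinal tN))/=; ring.
have shift e : \sum_t stat (d e) g t o = psum (cent e) N o + N%:R * mu e o.
  rewrite psum_full sumrB sumr_const card_ord -(mulr_natl (mu e o)).
  by rewrite subrK.
under eq_bigr do rewrite shift.
have -> : \sum_e (psum (cent e) N o + N%:R * mu e o) ^+ 2 =
    \sum_e psum (cent e) N o ^+ 2 + 2 * N%:R * \sum_e mu e o * psum (cent e) N o
    + N%:R ^+ 2 * v o.
  by rewrite !mulr_sumr -!big_split/=; apply: eq_bigr => e _; ring.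
have -> : \sum_e mu e o * psum (cent e) N o = \sum_t (stat dB g t o - v o).
  under eq_bigr do rewrite psum_full mulr_sumr.
  rewrite exchange_big/=; apply: eq_bigr => t _.
  under eq_bigr do rewrite mulrBr.
  rewrite sumrB; congr (_ - _).
  rewrite (bigD1 (E (lab t o) o))//= big1 ?addr0.
    by rewrite /stat eqxx mul1r.
  by move=> e; rewrite /stat eq_sym => /negbTE ->; rewrite mul0r mulr0.
have -> : \sum_e psum (cent e) N o ^+ 2 = 2 * psum degenerate_incr N o +
    \sum_t (sqr_stat t o - 2 * stat dB g t o + v o).
  by rewrite sqr_sum//; congr (_ + _); rewrite psum_full; apply: eq_bigr.
(* The diagonal terms account for the [- 2] in the coefficient of the projection and for the
   [- N%:R] in that of [v]. *)
rewrite big_split/= sumrB.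
have -> : \sum_t 2 * stat dB g t o = 2 * \sum_t stat dB g t o by rewrite mulr_sumr.
by rewrite sumr_const card_ord sumrB sumr_const card_ord -!(mulr_natl (v o)); ring.
Qed.

Definition cluster_prob (e : 'I_N) (o : Om) : R := \sum_j p j o * (d e) j o.

Let P0 e o : 0 <= cluster_prob e o.
Proof. by apply: sumr_ge0 => j _; rewrite mulr_ge0. Qed.

Lemma rint_pker_bound (f : X * Y -> R) (C : R) y : measurable_fun setT f ->
  (forall q, `|f q| <= C) -> `|Kop f y| <= C.
Proof.
move=> mf fC.
have bf : bounded_meas (fun t => f (y, t)).
  by split; [exact: measurable_fun_pair2|exists C].
have bC : bounded_meas (fun _ : Y => C) by exact: bounded_meas_cst.
have KC r : rint (fker_measure K y) (fun _ => r) = r.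
  by rewrite rint_cst/= /fker_at prob_kernel mulr1.
rewrite ler_norml; apply/andP; split.
  rewrite -(KC (- C)); apply: (le_rint (fker_measure K y)) => //.
    exact: bounded_meas_cst.
  by move=> t; have := fC (y, t); rewrite ler_norml => /andP[].
rewrite -[leRHS](KC C); apply: (le_rint (fker_measure K y)) => // t.
by have := fC (y, t); rewrite ler_norml => /andP[].
Qed.

Lemma cmean_bound (D : 'I_N -> Om -> R) (f : X * Y -> R) (C : R) o :
  measurable_fun setT f -> (forall q, `|f q| <= C) -> (forall j, 0 <= D j o) ->
  `|cmean D f o| <= C * \sum_j p j o * D j o.
Proof.
move=> mf fC D0; rewrite /cmean mulr_sumr (le_trans (ler_norm_sum _ _ _))//.
apply: ler_sum => j _; rewrite !normrM (ger0_norm (p0 _ _)) (ger0_norm (D0 _)).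
rewrite mulrA mulrC ler_wpM2r ?mulr_ge0//.
exact: rint_pker_bound.
Qed.

Lemma rint_prob_le (f : Om -> R) (r : R) : bounded_meas f ->
  (forall o, f o <= r) -> Ex f <= r.
Proof.
move=> bf fr; have <- : Ex (fun _ => r) = r.
  rewrite rint_cst -[RHS]mulr1; congr (_ * _).
  exact: (congr1 fine (probability_setT P)).
by apply: le_rint => //; exact: bounded_meas_cst.
Qed.

(** After division by [N] the decomposition leaves the error [(2 W + Sa + (2 N - 2) SB) / N], with
    [W] the degenerate part, [Sa] the fluctuation of the diagonal and [SB] the projection. Bounding
    the square of a sum of three terms costs a factor 3, whence the constants 12, 3 and 12. The
    contributions of [W] and [Sa] are of order [1 / N], that of [SB] is of order [1 / sqrt N]. *)
Lemma cluster_moment (C kap : R) : (0 < N)%N -> 0 <= kap ->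
  (forall q, `|g q| <= C) ->
  (forall o, c o = 0 \/
     (c o = 1 /\ N%:R * \sum_e cluster_prob e o ^+ 2 <= kap)) ->
  Ex (fun o => c o * (N%:R^-1 * \sum_e (\sum_t stat (d e) g t o) ^+ 2
       - cmean one (fun q => g q ^+ 2) o - (N%:R - 1) * v o) ^+ 2) <=
  C ^+ 4 * (3 * (4 * kap + 1) / N%:R + 12 * kap * Num.sqrt (kap / N%:R)).
Proof.
move=> N0 kap0 gC hc.
have C0 : 0 <= C by rewrite (le_trans _ (gC point)).
have mg : measurable_fun setT g by exact: bg.1.
have N0R : 0 < N%:R :> R by rewrite ltr0n.
have NN : N%:R != 0 :> R by rewrite gt_eqF.
have bcO := past_bounded_meas _ bc.
have bmuO e := past_bounded_meas _ (bmu e).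
have bg2 : bounded_meas (fun q => g q ^+ 2) by exact: bounded_measX.
have g2C q : `|g q ^+ 2| <= C ^+ 2 by rewrite normrX lerXn2r ?nnegrE.
have b1 (j : 'I_N) : bounded_meas (one j : past -> R) by exact: bounded_meas_cst.
have bdB j : bounded_meas (dB j : past -> R).
  rewrite (_ : dB j = (fun o => \sum_e mu e o * (d e) j o)).
    by apply: bounded_meas_sum => e; exact: bounded_measM.
  apply/funext => o; rewrite (bigD1 (E j o))//= eqxx mulr1 big1 ?addr0// => e.
  by rewrite eq_sym => /negbTE ->; rewrite mulr0.
have dBmean o : cmean dB g o = v o.
  transitivity (\sum_j \sum_e mu e o * (p j o * ((d e) j o * Kop g (x j o)))).
    apply: eq_bigr => j _; rewrite [RHS](bigD1 (E j o))//= eqxx mul1r big1 ?addr0; first by ring.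
    by move=> e; rewrite eq_sym => /negbTE ->; rewrite mul0r !mulr0.
  rewrite exchange_big/=; apply: eq_bigr => e _.
  by rewrite -mulr_sumr expr2.
have s2P e o : s2 e o ^+ 2 <= C ^+ 4 * cluster_prob e o ^+ 2.
  rewrite (_ : C ^+ 4 * _ = (C ^+ 2 * cluster_prob e o) ^+ 2); last by ring.
  rewrite -real_normK ?num_real// lerXn2r ?nnegrE ?mulr_ge0 ?sqr_ge0//.
  by apply: cmean_bound => //; exact: bg2.1.
have muP e o : `|mu e o| <= C * cluster_prob e o by exact: cmean_bound.
pose W o := psum degenerate_incr N o.
pose Sa o := psum (fun t o => sqr_stat t o - cmean one (fun q => g q ^+ 2) o) N o.
pose SB o := psum (fun t o => stat dB g t o - cmean dB g o) N o.
(* [s2 e] is at most [C ^+ 2] times the probability of cluster [e], so where [c] is 1 the sum of its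
   squares is at most [C ^+ 4 * (kap / N%:R)]. *)
have hW : Ex (fun o => c o * W o ^+ 2) <= C ^+ 4 * (N%:R * kap).
  apply: (le_trans degenerate_moment).
  have h : Ex (fun o => c o * \sum_e s2 e o ^+ 2) <= C ^+ 4 * (kap / N%:R).
    apply: rint_prob_le.
      apply: bounded_measM => //; apply: bounded_meas_sum => e; apply: bounded_measX.
      by apply: past_bounded_meas; exact: bounded_cmean.
    move=> o; have [->|[-> hk]] := hc o; first by rewrite mul0r mulr_ge0 ?exprn_ge0 ?divr_ge0.
    rewrite mul1r (le_trans (ler_sum _ (fun e _ => s2P e o)))// -mulr_sumr.
    by rewrite ler_wpM2l ?exprn_ge0// ler_pdivlMr// mulrC.
  rewrite mulrA -expr2; apply: (le_trans (ler_wpM2l (sqr_ge0 _) h)).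
  by rewrite le_eqVlt; apply/orP; left; apply/eqP; field.
have hSa : Ex (fun o => c o * Sa o ^+ 2) <= C ^+ 4 * N%:R.
  apply: (le_trans (lln_moment c one _ N bc c0 b1 bg2 (leqnn _))).
  rewrite mulrC ler_wpM2r ?ler0n//; apply: rint_prob_le.
    apply: bounded_measM => //; apply: past_bounded_meas; apply: bounded_cmean.
      by move=> j; exact: (bounded_measX _ 2 (b1 j)).
    exact: bounded_measX.
  move=> o; have g4 : cmean (fun j o => one j o ^+ 2) (fun q => (g q ^+ 2) ^+ 2) o <= C ^+ 4.
    rewrite (le_trans (ler_norm _))//.
    apply: (le_trans (cmean_bound _ _ (C ^+ 4) _ _ _ _)) => //.
    - exact: (bounded_measX _ 2 bg2).1.
    - by move=> q; rewrite -exprM normrX lerXn2r ?nnegrE.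
    under eq_bigr do rewrite expr1n mulr1.
    by rewrite p1 mulr1.
  have [->|[-> _]] := hc o; first by rewrite mul0r exprn_ge0.
  by rewrite mul1r.
have hSB : Ex (fun o => c o * SB o ^+ 2) <= C ^+ 4 * (kap * Num.sqrt (kap / N%:R)).
  apply: (le_trans (lln_moment c dB g N bc c0 bdB bg (leqnn _))).
  rewrite mulrC -ler_pdivlMr//; apply: rint_prob_le.
    apply: bounded_measM => //; apply: past_bounded_meas; apply: bounded_cmean => //.
    by move=> j; exact: (bounded_measX _ 2 (bdB j)).
  move=> o; have [->|[-> hk]] := hc o.
    by rewrite mul0r !mulr_ge0 ?exprn_ge0 ?sqrtr_ge0 ?invr_ge0 ?ler0n.
  rewrite mul1r (le_trans (ler_norm _))//.
  apply: (le_trans (cmean_bound _ _ (C ^+ 2) _ _ _ _)) => //.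
  - exact: bg2.1.
  - by move=> j; exact: sqr_ge0.
  (* Here the cubes of the cluster probabilities must be summed: one factor is bounded by the square
     root of the sum of all squares, the other two are left to that sum. *)
  have Ps e : cluster_prob e o <= Num.sqrt (kap / N%:R).
    rewrite -(ger0_norm (P0 e o)) -sqrtr_sqr ler_wsqrtr// ler_pdivlMr// mulrC.
    rewrite (le_trans _ hk)// ler_pM2l// (bigD1 e)//= lerDl.
    by apply: sumr_ge0 => e' _; exact: sqr_ge0.
  have -> : \sum_j p j o * mu (E j o) o ^+ 2 = \sum_e cluster_prob e o * mu e o ^+ 2.
    rewrite /cluster_prob; under [in RHS]eq_bigr do rewrite mulr_suml.
    rewrite exchange_big/=; apply: eq_bigr => j _.
    rewrite (bigD1 (E j o))//= eqxx mulr1 big1 ?addr0// => e.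
    by rewrite eq_sym => /negbTE ->; rewrite mulr0 mul0r.
  have h : \sum_e cluster_prob e o * mu e o ^+ 2 <=
      C ^+ 2 * (Num.sqrt (kap / N%:R) * (kap / N%:R)).
    apply: (@le_trans _ _ (\sum_e C ^+ 2 * (Num.sqrt (kap / N%:R) * cluster_prob e o ^+ 2))).
      apply: ler_sum => e _.
      have h1 : mu e o ^+ 2 <= C ^+ 2 * cluster_prob e o ^+ 2.
        rewrite -exprMn -real_normK ?num_real// lerXn2r ?nnegrE ?mulr_ge0//.
      rewrite [leRHS]mulrCA; apply: ler_pM => //; exact: sqr_ge0.
    rewrite -!mulr_sumr ler_wpM2l ?sqr_ge0// ler_wpM2l ?sqrtr_ge0//.
    by rewrite ler_pdivlMr// mulrC.
  apply: (le_trans (ler_wpM2l (sqr_ge0 C) h)).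
  by rewrite le_eqVlt; apply/orP; left; apply/eqP; field.
have bW : bounded_meas (fun o => c o * W o ^+ 2).
  apply: bounded_measM => //; apply: bounded_measX; rewrite /W psumE.
  apply: bounded_meas_sum => i; case: (boolP (i < _)%N) => it; last exact: bounded_meas_cst.
  apply: bounded_meas_sum => e; apply: bounded_measM => //.
  by apply: bounded_measB => //; exact: bounded_stat.
have bS D f : (forall j, bounded_meas (D j : past -> R)) -> bounded_meas f ->
    bounded_meas (fun o => c o * psum (fun t o => stat D f t o - cmean D f o) N o ^+ 2).
  move=> bD bf; apply: bounded_measM => //; apply: bounded_measX; rewrite psumE.
  apply: bounded_meas_sum => i; case: (boolP (i < _)%N) => it; last exact: bounded_meas_cst.
  apply: bounded_measB; first exact: bounded_stat.
  by apply: past_bounded_meas; exact: bounded_cmean.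
have bSa := bS _ _ b1 bg2; have bSB := bS _ _ bdB bg.
pose U o := 12 / N%:R ^+ 2 * (c o * W o ^+ 2) +
  (3 / N%:R ^+ 2 * (c o * Sa o ^+ 2) + 12 * (c o * SB o ^+ 2)).
have bZ r f : bounded_meas f -> bounded_meas (fun o : Om => r * f o).
  by move=> bf; apply: bounded_measM => //; exact: bounded_meas_cst.
have EU : Ex U = 12 / N%:R ^+ 2 * Ex (fun o => c o * W o ^+ 2) +
    (3 / N%:R ^+ 2 * Ex (fun o => c o * Sa o ^+ 2) + 12 * Ex (fun o => c o * SB o ^+ 2)).
  rewrite /U rintD; [|exact: bZ|by apply: bounded_measD; exact: bZ].
  by rewrite rintD; [|exact: bZ|exact: bZ]; rewrite !rintZ.
apply: (@le_trans _ _ (Ex U)).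
  apply: le_rint.
  - apply: bounded_measM => //; apply: bounded_measX; apply: bounded_measB.
      apply: bounded_measB.
        apply: bZ; apply: bounded_meas_sum => e; apply: bounded_measX.
        by apply: bounded_meas_sum => t; exact: bounded_stat.
      by apply: past_bounded_meas; exact: bounded_cmean.
    by apply: bZ; apply: bounded_meas_sum => e; exact: bounded_measX.
  - by apply: bounded_measD; [exact: bZ|apply: bounded_measD; exact: bZ].
  move=> o; rewrite cluster_decomposition.
  have eSB : \sum_t (stat dB g t o - v o) = SB o.
    by rewrite /SB psum_full; apply: eq_bigr => t _; rewrite dBmean.
  have eSa : \sum_t sqr_stat t o = Sa o + N%:R * cmean one (fun q => g q ^+ 2) o.
    by rewrite /Sa psum_full sumrB sumr_const card_ord -(mulr_natl (cmean _ _ o)) subrK.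
  rewrite eSB eSa -/(W o).
  set m := cmean _ _ o; set w := W o; set a := Sa o; set b := SB o; set vv := v o.
  set n := N%:R.
  rewrite (_ : n^-1 * _ - _ - _ = n^-1 * (2 * w + a + (2 * n - 2) * b)); last by field.
  rewrite /U -/w -/a -/b -/n.
  rewrite (_ : 12 / n ^+ 2 * _ + _ = c o * (n^-1 ^+ 2 *
     (3 * ((2 * w) ^+ 2 + a ^+ 2 + (2 * n * b) ^+ 2)))); last by field.
  rewrite ler_wpM2l// exprMn ler_wpM2l ?sqr_ge0//.
  (* The gap in the three-term inequality is the sum of the squared pairwise differences; afterwards
     [2 * n - 2] is enlarged to [2 * n]. *)
  apply: (@le_trans _ _ (3 * ((2 * w) ^+ 2 + a ^+ 2 + ((2 * n - 2) * b) ^+ 2))).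
    set u := 2 * w; set r := (2 * n - 2) * b.
    rewrite -subr_ge0 (_ : _ - _ = (u - a) ^+ 2 + (u - r) ^+ 2 + (a - r) ^+ 2); last by ring.
    by rewrite !addr_ge0 ?sqr_ge0.
  rewrite ler_wpM2l// lerD2l -subr_ge0.
  rewrite (_ : _ - _ = (8 * (n - 1) + 4) * b ^+ 2); last by ring.
  by rewrite mulr_ge0 ?sqr_ge0// addr_ge0// mulr_ge0// subr_ge0 ler1n.
rewrite EU (_ : C ^+ 4 * _ = 12 / N%:R ^+ 2 * (C ^+ 4 * (N%:R * kap)) +
  (3 / N%:R ^+ 2 * (C ^+ 4 * N%:R) + 12 * (C ^+ 4 * (kap * Num.sqrt (kap / N%:R)))));
  last by field.
by rewrite !lerD// ler_wpM2l// ?divr_ge0 ?sqr_ge0.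
Qed.
End Moments.
End OneStep.

(** * Convergence in probability *)

Section ConvergenceInProbability.
Context {R : realType} {dO : nat -> measure_display}
  {Om : forall N, measurableType (dO N)} (P : forall N, probability (Om N) R).
Implicit Types (Y Z : forall N, Om N -> R).

(** The limit is a constant and the spaces vary with [N], so no joint law across [N] enters.
    Measurability is recorded because deviation events are compared through monotonicity of the
    measure. *)
Definition cvp Y (y : R) : Prop :=
  (forall N, measurable_fun setT (Y N)) /\
  forall e, 0 < e -> (fun N => P N [set o | e < `|Y N o - y|]) @ \oo --> 0%E.

Let cvg0P (u : nat -> \bar R) : (forall N, 0 <= u N)%E ->
  (u @ \oo --> 0%E) <-> (forall e : R, 0 < e -> \forall N \near \oo, (u N <= e%:E)%E).
Proof.
move=> u0; split.
  move=> cu e e0; have := cu; rewrite (_ : 0%E = 0%:E :> \bar R)// =>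
    /fine_cvgP[fu /cvgrPdist_le/(_ e e0) h].
  near=> N; have fN : u N \is a fin_num by near: N.
  rewrite -(fineK fN) lee_fin (le_trans (ler_norm _))//.
  by rewrite -normrN -sub0r; near: N.
move=> h; rewrite (_ : 0%E = 0%:E :> \bar R)//; apply/fine_cvgP; split.
  near=> N; rewrite ge0_fin_numE//; apply: (@le_lt_trans _ _ 1%:E); last exact: ltry.
  by near: N; exact: h.
apply/cvgrPdist_le => e e0; near=> N.
have hN : (u N <= e%:E)%E by near: N; exact: h.
have fN : u N \is a fin_num by rewrite ge0_fin_numE// (le_lt_trans hN)// ltry.
by rewrite /= sub0r normrN ger0_norm ?fine_ge0// -lee_fin fineK.
Unshelve. all: by end_near. Qed.

Lemma measurable_dev (d : measure_display) (T : measurableType d) (f : T -> R) y e :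
  measurable_fun setT f -> measurable [set o | e < `|f o - y|].
Proof.
move=> mf; rewrite -[X in measurable X]setTI.
rewrite (_ : [set o | e < `|f o - y|] = ~` [set o | `|f o - y| <= e]); last first.
  by apply/seteqP; split => o /=; rewrite ltNge; [move/negP|move=> ?; apply/negP].
rewrite setTI; apply: measurableC; rewrite -[X in measurable X]setTI.
apply: measurable_fun_le => //.
by apply: measurableT_comp => //; exact: measurable_funB.
Qed.

Lemma cvpP Y y : (forall N, measurable_fun setT (Y N)) ->
  (forall e d, 0 < e -> 0 < d -> \forall N \near \oo,
     (P N [set o | (e < `|Y N o - y|)%R] <= d%:E)%E) -> cvp Y y.
Proof. by move=> mY h; split => // e e0; apply/cvg0P => // d d0; exact: h. Qed.

Lemma cvp_near Y y : cvp Y y -> forall e d, 0 < e -> 0 < d -> \forall N \near \oo,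
  (P N [set o | (e < `|Y N o - y|)%R] <= d%:E)%E.
Proof. by move=> [_ h] e d e0 d0; have /cvg0P := h _ e0; apply. Qed.

(** Continuity of [phi] is asked at the limit point only, which covers inversion at a nonzero
    limit. *)
Lemma cvp_map2 (phi : R -> R -> R) Y Z y z : cvp Y y -> cvp Z z ->
  (forall N, measurable_fun setT (fun o => phi (Y N o) (Z N o))) ->
  phi q.1 q.2 @[q --> (y, z)] --> phi y z ->
  cvp (fun N o => phi (Y N o) (Z N o)) (phi y z).
Proof.
move=> cY cZ mphi /cvgrPdist_le cphi; apply: cvpP => // e d e0 d0.
have [r /= r0 hr] := (nbhs_ballP _ _).1 (cphi _ e0).
have r2 : 0 < r / 2 by rewrite divr_gt0.
have d2 : 0 < d / 2 by rewrite divr_gt0.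
near=> N.
have hY : (P N [set o | (r / 2 < `|Y N o - y|)%R] <= (d / 2)%:E)%E.
  by near: N; exact: cvp_near.
have hZ : (P N [set o | (r / 2 < `|Z N o - z|)%R] <= (d / 2)%:E)%E.
  by near: N; exact: cvp_near.
have mY := measurable_dev _ _ _ y (r / 2) (cY.1 N).
have mZ := measurable_dev _ _ _ z (r / 2) (cZ.1 N).
apply: (@le_trans _ _ (P N ([set o | r / 2 < `|Y N o - y|] `|` [set o | r / 2 < `|Z N o - z|]))).
  apply: le_measure; rewrite ?inE.
  - exact: (measurable_dev _ _ (fun o => phi (Y N o) (Z N o))).
  - exact: measurableU.
  move=> o /= he; apply: contrapT => /not_orP[/negP]; rewrite -leNgt => h1 /negP.
  rewrite -leNgt => h2; move: he; apply/negP; rewrite -leNgt.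
  rewrite distrC; apply: (hr (Y N o, Z N o)); split => /=; rewrite /ball/= distrC;
    [apply: (le_lt_trans h1)|apply: (le_lt_trans h2)]; lra.
apply: (le_trans (measureU2 _ _ _)) => //.
by rewrite (splitr d) EFinD leeD.
Unshelve. all: by end_near. Qed.

Lemma cvp_cst (r : R) : cvp (fun _ _ => r) r.
Proof.
apply: cvpP => [N|e d e0 d0]; first exact: measurable_cst.
apply: nearW => N; rewrite (_ : [set o | _] = set0) ?measure0 ?lee_fin ?ltW//.
by apply/seteqP; split => // o /=; rewrite subrr normr0 ltNge ltW.
Qed.

Lemma cvpD Y Z y z : cvp Y y -> cvp Z z -> cvp (fun N o => Y N o + Z N o) (y + z).
Proof.
move=> cY cZ; apply: (@cvp_map2 (fun a b => a + b)) => //.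
  by move=> N; apply: measurable_funD; [exact: cY.1|exact: cZ.1].
by apply: cvgD; [exact: cvg_fst|exact: cvg_snd].
Qed.

Lemma cvpB Y Z y z : cvp Y y -> cvp Z z -> cvp (fun N o => Y N o - Z N o) (y - z).
Proof.
move=> cY cZ; apply: (@cvp_map2 (fun a b => a - b)) => //.
  by move=> N; apply: measurable_funB; [exact: cY.1|exact: cZ.1].
by apply: cvgB; [exact: cvg_fst|exact: cvg_snd].
Qed.

Lemma cvpM Y Z y z : cvp Y y -> cvp Z z -> cvp (fun N o => Y N o * Z N o) (y * z).
Proof.
move=> cY cZ; apply: (@cvp_map2 (fun a b => a * b)) => //.
  by move=> N; apply: measurable_funM; [exact: cY.1|exact: cZ.1].
by apply: cvgM; [exact: cvg_fst|exact: cvg_snd].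
Qed.

Lemma cvpV Y y : y != 0 -> cvp Y y -> cvp (fun N o => (Y N o)^-1) (y^-1).
Proof.
move=> y0 cY; apply: (@cvp_map2 (fun a _ => a^-1) Y Y y y) => //.
  by move=> N; apply: measurable_funV; exact: cY.1.
by apply: cvgV => //; exact: cvg_fst.
Qed.

Lemma cvp_real (u : nat -> R) (r : R) : u @ \oo --> r -> cvp (fun N _ => u N) r.
Proof.
move=> /cvgrPdist_le cu; apply: cvpP => [N|e d e0 d0]; first exact: measurable_cst.
near=> N; rewrite (_ : [set o | _] = set0) ?measure0 ?lee_fin ?ltW//.
apply/seteqP; split => // o /=; rewrite ltNge distrC => /negP; apply.
by near: N; exact: cu.
Unshelve. all: by end_near. Qed.

Lemma cvp_ext Y Z y : (forall N, measurable_fun setT (Z N)) ->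
  (\forall N \near \oo, Y N =1 Z N) -> cvp Y y -> cvp Z y.
Proof.
move=> mZ YZ cY; apply: cvpP => // e d e0 d0; near=> N.
have -> : Z N = Y N by apply/funext => o; apply/esym; move: o; near: N.
by near: N; exact: cvp_near.
Unshelve. all: by end_near. Qed.

Lemma cvp_eq Y Z y : (forall N, Y N =1 Z N) -> cvp Y y -> cvp Z y.
Proof.
by move=> YZ; rewrite (_ : Y = Z)//; apply: functional_extensionality_dep => N; exact/funext.
Qed.

Lemma cvp_le_bound Y y k : cvp Y y -> y < k ->
  (fun N => P N (~` [set o | Y N o <= k])) @ \oo --> 0%E.
Proof.
move=> cY yk; apply/cvg0P => // d d0; near=> N.
have mA : measurable [set o | Y N o <= k].
  by rewrite -[X in measurable X]setTI; apply: measurable_fun_le => //; exact: cY.1.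
apply: (@le_trans _ _ (P N [set o | (k - y) / 2 < `|Y N o - y|])); last first.
  by near: N; apply: cvp_near => //; rewrite divr_gt0// subr_gt0.
apply: le_measure; rewrite ?inE.
- exact: measurableC.
- exact/measurable_dev/cY.1.
move=> o /= /negP; rewrite -ltNge => kY; rewrite (lt_le_trans _ (ler_norm _))//; lra.
Unshelve. all: by end_near. Qed.

(** A deviation above [e] either falls outside [A N] or contributes at least [e ^+ 2] to the second
    moment localised to [A N]. *)
Lemma cvp_chebyshev (D : forall N, Om N -> R) (A : forall N, set (Om N)) (v : nat -> R) :
  (forall N, bounded_meas (D N)) -> (forall N, measurable (A N)) ->
  (fun N => P N (~` A N)) @ \oo --> 0%E ->
  (\forall N \near \oo, rint (P N) (fun o => \1_(A N) o * D N o ^+ 2) <= v N) ->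
  v @ \oo --> 0 -> cvp D 0.
Proof.
move=> bD mA /cvg0P cA hv cv; apply: cvpP => [N|e d e0 d0]; first exact: (bD N).1.
have de : 0 < d / 2 * e ^+ 2 by rewrite mulr_gt0 ?divr_gt0 ?exprn_gt0.
have d2 : 0 < d / 2 by rewrite divr_gt0.
move: cv => /cvgrPdist_le/(_ _ de) cv.
near=> N.
have h1 : rint (P N) (fun o => \1_(A N) o * D N o ^+ 2) <= v N by near: N.
have h2 : v N <= d / 2 * e ^+ 2.
  by rewrite (le_trans (ler_norm _))// -normrN -sub0r; near: N.
have h3 : (P N (~` A N) <= (d / 2)%:E)%E by near: N; exact: cA.
have mE := measurable_dev _ _ _ 0 e (bD N).1.
have mAC := measurableC (mA N).
move: h3; rewrite !rint_indicE// !lee_fin => h3.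
have bA : bounded_meas (\1_(A N) : Om N -> R) by exact: bounded_meas_indic.
have b1 : bounded_meas (fun o => \1_(A N) o * D N o ^+ 2).
  by apply: bounded_measM => //; exact: bounded_measX.
have b2 : bounded_meas (fun o => (e ^+ 2)^-1 * (\1_(A N) o * D N o ^+ 2)).
  by apply: bounded_measM => //; exact: bounded_meas_cst.
have bAC : bounded_meas (\1_(~` A N) : Om N -> R) by exact: bounded_meas_indic.
apply: (@le_trans _ _ (rint (P N) (fun o => \1_(~` A N) o +
    (e ^+ 2)^-1 * (\1_(A N) o * D N o ^+ 2)))).
  apply: le_rint.
  - exact: bounded_meas_indic.
  - exact: bounded_measD.
  move=> o; have e20 : 0 <= (e ^+ 2)^-1 * D N o ^+ 2.
    by rewrite mulr_ge0 ?sqr_ge0// invr_ge0 sqr_ge0.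
  rewrite !indicE in_setC; case: (boolP (o \in A N)) => /= oA.
    rewrite mul1r add0r; case: (boolP (o \in _)) => // /[!inE]/= h.
    rewrite mulrC ler_pdivlMr ?exprn_gt0// mul1r -(real_normK (num_real (D N o))).
    by rewrite lerXn2r ?nnegrE ?(ltW e0)//; move: h; rewrite subr0 => /ltW.
  by rewrite mul0r mulr0 addr0; case: (_ \in _).
rewrite rintD// rintZ// (splitr d) lerD// mulrC ler_pdivrMr ?exprn_gt0//.
exact: le_trans h1 h2.
Unshelve. all: by end_near. Qed.
End ConvergenceInProbability.

(** * The particle filter as a conditionally independent sample *)

Lemma preimage_select {d} {T : measurableType d} {N N'} (lab : T -> 'I_N)
    (G : 'I_N -> T -> 'I_N') e :
  (forall j, measurable (lab @^-1` [set j])) ->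
  (forall j, measurable (G j @^-1` [set e])) ->
  measurable ((fun o => G (lab o) o) @^-1` [set e]).
Proof.
move=> ml mG.
rewrite (_ : _ @^-1` _ = \bigcup_(j in [set: 'I_N]) (lab @^-1` [set j] `&` G j @^-1` [set e])).
  by apply: fin_bigcup_measurable => // j _; exact: measurableI.
apply/seteqP; split => [ o /= Go|o [j _ [/= <-]]//].
by exists (lab o).
Qed.

Lemma bounded_meas_preimage {R : realType} {d} {T : measurableType d} {N}
    (lab : T -> 'I_N) j : measurable (lab @^-1` [set j]) ->
  bounded_meas (fun o => (lab o == j)%:R : R).
Proof.
move=> ml; have -> : (fun o => (lab o == j)%:R) = \1_(lab @^-1` [set j]) :> (T -> R).
  apply/funext => o; rewrite indicE; congr (nat_of_bool _)%:R.
  by apply/idP/idP; rewrite inE => /eqP.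
exact: bounded_meas_indic.
Qed.

Lemma measurable_select {R : realType} {d} {T : measurableType d} {N} (lab : T -> 'I_N)
    (F : 'I_N -> T -> R) :
  (forall j, measurable (lab @^-1` [set j])) ->
  (forall j, measurable_fun setT (F j)) ->
  measurable_fun setT (fun o => F (lab o) o).
Proof.
move=> ml mF.
rewrite (_ : (fun o => _) = (fun o => \sum_j (lab o == j)%:R * F j o)).
  apply: measurable_sum => j; apply: measurable_funM => //.
  exact: (bounded_meas_preimage lab j (ml j)).1.
apply/funext => o; rewrite (bigD1 (lab o))//= eqxx mul1r big1 ?addr0// => j.
by rewrite eq_sym => /negbTE ->; rewrite mul0r.
Qed.

Section APFFixed.
Context {R : realType} {dX : nat -> measure_display}
  {X : forall n, measurableType (dX n)}.
Variables (wm1 : X 0%N -> R) (theta : forall n, X n -> R)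
  (w : forall n, X n -> X n.+1 -> R).
Variables (nu : probability (X 0%N) R) (Pk : forall n, R.-pker (X n) ~> (X n.+1)).
Hypothesis Hwm1 : measurable_fun setT wm1 /\ (forall x, 0 < wm1 x) /\
  exists M : R, forall x, wm1 x <= M.
Hypothesis Htheta : forall n, measurable_fun setT (theta n) /\
  (forall x, 0 < theta n x) /\ exists M : R, forall x, theta n x <= M.
Hypothesis Hw : forall n,
  measurable_fun setT (fun p : X n * X n.+1 => w n p.1 p.2) /\
  (forall x y, 0 < w n x y) /\ exists M : R, forall x y, w n x y / theta n x <= M.
Variables (N : nat) (N0 : (0 < N)%N).
Context {dO : measure_display} {Om : measurableType dO}.
Variables (P : probability Om R) (xi : forall k, 'I_N -> Om -> X k)
  (I : forall k : nat, 'I_N -> Om -> 'I_N).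
Hypothesis HAPF : is_APF wm1 theta w N xi I nu Pk P.

Local Notation hist k := (history_gen N xi I k).
Local Notation F k := (g_sigma_algebraType (hist k)).
Local Notation om := (omega wm1 theta w N xi I).
Local Notation sp := (selprob wm1 theta w N xi I).

Lemma bounded_meas_theta n : bounded_meas (theta n).
Proof.
have [mt [t0 [M tM]]] := Htheta n; split => //; exists M => x.
by rewrite ger0_norm ?(ltW (t0 _)).
Qed.

Lemma bounded_meas_wm1 : bounded_meas wm1.
Proof.
have [mt [t0 [M tM]]] := Hwm1; split => //; exists M => x.
by rewrite ger0_norm ?(ltW (t0 _)).
Qed.

Definition wratio n (q : X n * X n.+1) : R := w n q.1 q.2 / theta n q.1.

Lemma wratio_gt0 n q : 0 < wratio n q.
Proof.
have [_ [w0 _]] := Hw n; have [_ [t0 _]] := Htheta n.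
by rewrite divr_gt0.
Qed.

Lemma bounded_meas_wratio n : bounded_meas (wratio n).
Proof.
have [mw [_ [M wM]]] := Hw n; have [mt _] := Htheta n; split.
  apply: measurable_funM => //; apply: measurable_funV.
  exact: measurableT_comp.
by exists M => q; rewrite ger0_norm ?(ltW (wratio_gt0 _ _))//; exact: wM.
Qed.

Lemma hist_measurable k : hist k `<=` measurable.
Proof.
have [mxi [mI _]] := HAPF.
move=> A [[m [i [B [_ [mB ->]]]]]|[m [i [j [_ ->]]]]]; last exact: mI.
by rewrite -[X in measurable X]setTI; exact: mxi.
Qed.

Lemma hist_mono k k' : (k <= k')%N -> <<s hist k >> `<=` <<s hist k' >>.
Proof.
move=> kk'; apply: sigma_generated_le => A hA; apply: sub_sigma_algebra.
case: hA => [[m [i [B [mk [mB ->]]]]]|[m [i [j [mk ->]]]]]; [left|right].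
  by exists m, i, B; split => //; exact: leq_trans mk kk'.
by exists m, i, j; split => //; exact: leq_trans mk kk'.
Qed.

Lemma hist_sub k A : <<s hist k >> A -> measurable A.
Proof.
by move: A; apply: smallest_sub; [exact: sigma_algebra_measurable|exact: hist_measurable].
Qed.

Lemma measurable_fun_hist {d} {U : measurableType d} k (f : Om -> U) :
  measurable_fun setT (f : F k -> U) -> measurable_fun setT f.
Proof.
move=> mf _ B mB; rewrite setTI; apply: (hist_sub k).
by have := mf measurableT B mB; rewrite setTI.
Qed.

Lemma xi_hist k m i : (m <= k)%N -> measurable_fun setT (xi m i : F k -> X m).
Proof.
move=> mk _ B mB; rewrite setTI; apply: sub_sigma_algebra; left.
by exists m, i, B.
Qed.

Lemma I_hist k m i j : (m < k)%N -> @measurable _ (F k) (I m i @^-1` [set j]).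
Proof. by move=> mk; apply: sub_sigma_algebra; right; exists m, i, j. Qed.

Lemma omega_gt0 k i o : 0 < om k i o.
Proof.
case: k => [|k] /=; first by case: Hwm1 => _ [].
exact: (wratio_gt0 k (_, _)).
Qed.

Lemma bounded_omega k i : bounded_meas (om k i : F k -> R).
Proof.
case: k => [|k] /=.
  apply: (bounded_meas_comp wm1 (xi 0%N i : F 0%N -> X 0%N)); first exact: bounded_meas_wm1.
  exact: xi_hist.
split.
  have mpair j : measurable_fun setT (fun o : F k.+1 => (xi k j o, xi k.+1 i o)).
    by apply: measurable_fun_pair; exact: xi_hist.
  apply: (@measurable_select _ _ (F k.+1) _ (I k i) (fun j o => wratio k (xi k j o, xi k.+1 i o))).
    by move=> j; exact: I_hist.
  by move=> j; exact: (bounded_meas_comp _ _ (bounded_meas_wratio k) (mpair j)).1.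
have [_ [M hM]] := bounded_meas_wratio k; exists M => o.
exact: (hM (_, _)).
Qed.

Lemma Enoch_hist l k i e : @measurable _ (F k) (Enoch N I l k i @^-1` [set e]).
Proof.
elim: k i => [|k IH] i /=.
  have [<-|ie] := eqVneq i e.
    by rewrite (_ : _ @^-1` _ = setT)//; apply/seteqP; split.
  rewrite (_ : _ @^-1` _ = set0)//; apply/seteqP; split => // o /= h.
  by move: ie; rewrite h eqxx.
case: leqP => lk; last first.
  have [<-|ie] := eqVneq i e.
    by rewrite (_ : _ @^-1` _ = setT)//; apply/seteqP; split.
  rewrite (_ : _ @^-1` _ = set0)//; apply/seteqP; split => // o /= h.
  by move: ie; rewrite h eqxx.
apply: (@preimage_select _ (F k.+1) _ _ (I k i) (Enoch N I l k)).
  by move=> j; exact: I_hist.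
by move=> j; apply: (hist_mono k k.+1) => //; exact: IH.
Qed.

Lemma bounded_hist_comp k i (f : X k -> R) : bounded_meas f ->
  bounded_meas (fun o : F k => f (xi k i o)).
Proof. by move=> bf; exact: (bounded_meas_comp _ _ bf (xi_hist k k i (leqnn k))). Qed.

Lemma sum_omega_gt0 k (f : X k -> R) o : (forall x, 0 < f x) ->
  0 < \sum_i om k i o * f (xi k i o).
Proof.
move=> f0; rewrite (bigD1 (Ordinal N0))//=.
rewrite ltr_pwDl//; first by rewrite mulr_gt0// omega_gt0.
by apply: sumr_ge0 => i _; rewrite mulr_ge0 ?(ltW (omega_gt0 _ _ _))// ltW.
Qed.

Lemma selprob_ge0 k j o : 0 <= sp k j o.
Proof.
have [_ [t0 _]] := Htheta k.
by rewrite divr_ge0 ?mulr_ge0 ?(ltW (omega_gt0 _ _ _)) ?(ltW (t0 _)) ?ltW ?sum_omega_gt0.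
Qed.

Lemma sum_selprob k o : \sum_j sp k j o = 1.
Proof.
have [_ [t0 _]] := Htheta k.
by rewrite -mulr_suml mulfV// gt_eqF// sum_omega_gt0.
Qed.

Lemma APF_cond_iid k : cond_iid P N (hist k) (xi k) (I k) (xi k.+1) (sp k) (Pk k).
Proof.
have [mxi [mI [_ law]]] := HAPF.
split; first exact: hist_measurable.
split; first by move=> j; exact: xi_hist.
split; first by [].
split; first by [].
split.
  have bot j : bounded_meas (fun o : F k => om k j o * theta k (xi k j o)).
    apply: bounded_measM; first exact: bounded_omega.
    by apply: bounded_hist_comp; exact: bounded_meas_theta.
  move=> j; apply: measurable_funM; first exact: (bot j).1.
  by apply: measurable_funV; apply: measurable_sum => i; exact: (bot i).1.
split; first exact: selprob_ge0.
split; first exact: sum_selprob.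
exact: law.
Qed.

(* The initial sample is cast as a one-step sample: trivial past, one-point state space,
   and every label equal to 0. *)
Let nuK : R.-pker unit ~> X 0%N :=
  kprobability (@measurable_cst _ _ unit (pprobability (X 0%N) R) setT nu).

Lemma init_cond_iid : cond_iid P N set0 (fun _ _ => tt) (fun _ _ => Ordinal N0)
  (xi 0%N) (fun j _ => (j == Ordinal N0)%:R) nuK.
Proof.
have [mxi [_ [law0 _]]] := HAPF.
split; first by [].
split; first by move=> j; exact: measurable_cst.
split.
  move=> i j; have [<-|ie] := eqVneq (Ordinal N0) j.
    by rewrite (_ : _ @^-1` _ = setT)//; apply/seteqP; split.
  rewrite (_ : _ @^-1` _ = set0)//; apply/seteqP; split => // o /= h.
  by move: ie; rewrite h eqxx.
split; first by [].
split; first by move=> j; exact: measurable_cst.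
split; first by [].
split.
  by move=> o; rewrite (bigD1 (Ordinal N0))//= ?eqxx big1 ?addr0// => j /negbTE ->.
move=> A J B HA mB.
(* The sigma-algebra generated by the empty family is trivial. *)
have : A = set0 \/ A = setT.
  apply: (HA [set A | A = set0 \/ A = setT]); split => //; split => /=.
  - by left.
  - by move=> C [->|->]; [right; rewrite setD0|left; rewrite setDT].
  - move=> C hC; have [[n Cn]|hn] := pselect (exists n, C n = setT).
      by right; apply/seteqP; split => // o _; exists n => //; rewrite Cn.
    left; apply/seteqP; split => // o [n _]; have [->//|Cn] := hC n.
    by exfalso; apply: hn; exists n.
case=> ->; first by rewrite set0I measure0 integral_set0.
rewrite setTI; have [hJ|/existsNP[i hi]] := pselect (forall i, J i = Ordinal N0).
  rewrite (_ : \bigcap_(i in _) _ = \bigcap_(i in [set: 'I_N]) (xi 0%N i @^-1` B i)); last first.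
    apply/seteqP; split => o h i _; have := h i Logic.I; first by case.
    by split => //=; rewrite hJ.
  rewrite law0//; under eq_integral do
    under eq_bigr do rewrite hJ eqxx mul1e.
  rewrite integral_cst// [X in (_ * X)%E](_ : _ = 1%E) ?mule1//.
  exact: probability_setT.
(* A prescribed label other than 0 is never drawn, and its probability is a zero factor in the
   product. *)
rewrite (_ : \bigcap_(i in _) _ = set0); last first.
  apply/seteqP; split => // o /(_ i Logic.I)[/= h _].
  by apply: hi; rewrite -h.
rewrite measure0; apply/esym/integral0_eq => o _.
rewrite (bigD1 i)//=; have -> : (J i == Ordinal N0) = false by apply/eqP.
by rewrite !mul0e.
Qed.
End APFFixed.

(** * Feynman-Kac operators and the limiting variance *)

Section FeynmanKac.
Context {R : realType} {dX : nat -> measure_display}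
  {X : forall n, measurableType (dX n)}.
Variables (L : forall n, R.-fker (X n) ~> (X n.+1))
  (chi : {finite_measure set (X 0%N) -> \bar R}).

(** With upper index [d + m] the cast runs along a proof that a natural number equals itself, and
    all such proofs are equal; the recursions for [Lmn] are read off from this form. *)
Lemma Lmn_Lk d m (h : X (d + m)%N -> R) : Lmn L m (d + m) h = Lk L d m h.
Proof.
rewrite /Lmn; case: (leqP m (d + m)) => [le|]; last by rewrite ltnNge leq_addl.
move: (subnK le); rewrite addnK => e.
rewrite (eq_irrelevance e erefl).
by congr Lk.
Qed.

Lemma Lmn_id n (h : X n -> R) : Lmn L n n h = h.
Proof. exact: (Lmn_Lk 0 n h). Qed.

Lemma LmnS m n (h : X n.+1 -> R) : (m <= n)%N ->
  Lmn L m n.+1 h = Lmn L m n (Lop L n h).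
Proof.
move=> mn; have [d e] : exists d, n = (d + m)%N by exists (n - m)%N; rewrite subnK.
move: h; rewrite e => h; rewrite [RHS]Lmn_Lk.
exact: (Lmn_Lk d.+1 m h).
Qed.

Lemma chiL0 f : chiL L chi 0 f = rint chi f.
Proof. by rewrite /chiL Lmn_id. Qed.

Lemma chiLS n f : chiL L chi n.+1 f = chiL L chi n (Lop L n f).
Proof. by rewrite /chiL LmnS. Qed.

Lemma bounded_Lop n f : bounded_meas f -> bounded_meas (Lop L n f).
Proof. exact: bounded_meas_fker. Qed.

Lemma chiL_Lmn m n f : (m <= n)%N -> chiL L chi m (Lmn L m n f) = chiL L chi n f.
Proof.
elim: n f => [|n IH] f mn.
  by move: mn; rewrite leqn0 => /eqP ->; rewrite Lmn_id.
move: mn; rewrite leq_eqVlt => /predU1P[->|mn]; first by rewrite Lmn_id.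
by rewrite LmnS// IH// chiLS.
Qed.

(** The induction peels off the last kernel: composition with a kernel preserves the class, here
    used for functions of the second coordinate. *)
Lemma bc_chiL n : bc_functional (chiL L chi n).
Proof.
elim: n => [|n IH].
  have := bc_rint chi; congr bc_functional.
  by apply/funext => f; rewrite chiL0.
rewrite (_ : chiL L chi n.+1 = (fun f => chiL L chi n (Lop L n f))); last first.
  by apply/funext => f; rewrite chiLS.
have [bD [bZ bcv]] := bc_functional_fker (L n) _ IH.
have b2 (f : X n.+1 -> R) : bounded_meas f ->
    bounded_meas (fun q : X n * X n.+1 => f q.2).
  by move=> bf; exact: bounded_meas_comp.
split; first by move=> f g /b2 bf /b2 bg; exact: (bD _ _ bf bg).
split; first by move=> r f /b2 bf; exact: (bZ r _ bf).
move=> F f [mF [mf [[M hM] cF]]]; apply: (bcv (fun k q => F k q.2) (fun q => f q.2)).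
split; first by move=> k; exact: measurableT_comp.
split; first exact: measurableT_comp.
by split; [exists M|].
Qed.

Lemma chiL_ge0 n f : (forall x, 0 <= f x) -> 0 <= chiL L chi n f.
Proof.
elim: n f => [|n IH] f f0; first by rewrite chiL0; exact: rint_ge0.
rewrite chiLS; apply: IH => x; exact: (rint_ge0 (fker_measure (L n) x)).
Qed.

(* If the value at [f] were 0, so would be those at [min 1 (k f)], which increase to 1. *)
Lemma chiL_gt0 n f : 0 < chiL L chi n (fun _ => 1) -> bounded_meas f ->
  (forall x, 0 < f x) -> 0 < chiL L chi n f.
Proof.
move=> n1 bf f0; rewrite ltNge; apply/negP => fle.
pose F k x := Num.min 1 (k%:R * f x).
have bF k : bounded_meas (F k).
  split; first by apply: measurable_minr => //; apply: measurable_funM => //; exact: bf.1.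
  exists 1 => x; rewrite ger0_norm; first by rewrite ge_min lexx.
  by rewrite le_min ler01 mulr_ge0// ltW.
have h : chiL L chi n (F k) @[k --> \oo] --> chiL L chi n (fun _ => 1).
  apply: (bc_cvg _ (bc_chiL n)); split; first by move=> k; exact: (bF k).1.
  split; first exact: measurable_cst.
  split.
    exists 1 => k x; rewrite ger0_norm; first by rewrite ge_min lexx.
    by rewrite le_min ler01 mulr_ge0// ltW.
  move=> x; apply: cvg_near_cst; near=> k; rewrite /F min_l//.
  rewrite -ler_pdivrMr// mul1r; near: k; exact: nbhs_infty_ger.
have hle k : chiL L chi n (F k) <= 0.
  apply: (@le_trans _ _ (k%:R * chiL L chi n f)); last by rewrite mulr_ge0_le0.
  rewrite -(bcZ _ (bc_chiL n))//.
  have bk : bounded_meas (fun x => k%:R * f x).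
    by apply: bounded_measM => //; exact: bounded_meas_cst.
  rewrite -subr_ge0 -(bcB _ (bc_chiL n))//; apply: chiL_ge0 => x.
  by rewrite subr_ge0 /F ge_min lexx orbT.
have : chiL L chi n (fun _ => 1) <= 0.
  rewrite -(cvg_lim _ h)//; apply: (limr_le (cvgP _ h)); exact: nearW.
by rewrite leNgt n1.
Unshelve. all: by end_near. Qed.

Variables (wm1 : X 0%N -> R) (theta : forall n, X n -> R)
  (w : forall n, X n -> X n.+1 -> R).

Definition onestep_var m (f : X m.+1 -> R) (x : X m) : R :=
  (theta m x)^-1 * rint (L m x) (fun y => w m x y * f y ^+ 2).

(** The factors [chiL] at time [m] of the constant 1 cancel within each summand, so the asymptotic
    variance is this quantity at the centred function over the square of [chiL] at time [n] of 1.
    Left uncentred and unnormalised, it obeys a recursion in [n]. *)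
Definition unnorm_var (l n : nat) (f : X n -> R) : R :=
  (if l == 0%N then rint chi (fun x => wm1 x * (Lmn L 0 n f x) ^+ 2) else 0)
  + \sum_(l.-1 <= m < n) chiL L chi m (theta m) *
      chiL L chi m (onestep_var m (Lmn L m.+1 n f)).

Lemma asym_varE l n h : (forall m, 0 < chiL L chi m (fun _ => 1)) ->
  asym_var L chi wm1 theta w l n h =
  unnorm_var l n (fun x => h x - Defs.eta L chi n h) / (chiL L chi n (fun _ => 1)) ^+ 2.
Proof.
move=> c0; rewrite /asym_var /unnorm_var mulrDl; congr (_ + _).
  by case: ifP; rewrite ?mul0r.
rewrite mulr_suml; apply: eq_big_nat => m /andP[_ mn].
rewrite /Defs.eta chiL_Lmn; last exact: ltnW.
by field; rewrite !gt_eqF.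
Qed.

(** Every earlier term sees [f] through the composed kernels only, so one more step replaces [f] by
    [Lop L n f] and adds the noise of the last mutation. *)
Lemma unnorm_varS l n (f : X n.+1 -> R) : (l <= n)%N ->
  unnorm_var l n.+1 f = unnorm_var l n (Lop L n f) +
    chiL L chi n (theta n) * chiL L chi n (onestep_var n f).
Proof.
move=> ln; rewrite /unnorm_var LmnS// -addrA; congr (_ + _).
rewrite big_nat_recr/=; last by rewrite (leq_trans (leq_pred _)).
rewrite Lmn_id; congr (_ + _); apply: eq_big_nat => m /andP[_ mn].
by rewrite LmnS.
Qed.

Lemma unnorm_var0 (f : X 0%N -> R) :
  unnorm_var 0 0 f = chiL L chi 0 (fun x => wm1 x * f x ^+ 2).
Proof. by rewrite /unnorm_var/= big_geq// addr0 Lmn_id chiL0. Qed.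

Lemma unnorm_var_diag n (f : X n.+1 -> R) : unnorm_var n.+1 n.+1 f =
  chiL L chi n (theta n) * chiL L chi n (onestep_var n f).
Proof. by rewrite /unnorm_var/= add0r big_nat1 Lmn_id. Qed.
End FeynmanKac.

(** * Limit theorems for conditionally independent samples *)

Section CondIidLimits.
Context {R : realType} {dO : nat -> measure_display}
  {Om : forall N, measurableType (dO N)} (P : forall N, probability (Om N) R).
Context {d1 d2} {X : measurableType d1} {Y : measurableType d2}.
Variables (H : forall N, set (set (Om N))).
Variables (x : forall N, 'I_N.+1 -> Om N -> X)
  (lab : forall N, 'I_N.+1 -> Om N -> 'I_N.+1)
  (z : forall N, 'I_N.+1 -> Om N -> Y) (p : forall N, 'I_N.+1 -> Om N -> R).
Variables (K : R.-pker X ~> Y) (g : X * Y -> R).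
Hypothesis iid : forall N, cond_iid (P N) N.+1 (H N) (x N) (lab N) (z N) (p N) K.
Hypothesis bg : bounded_meas g.

Local Notation one := (fun _ _ => 1 : R).

Lemma cvg_cst_natSinv (r : R) : (r / N.+1%:R) @[N --> \oo] --> (0 : R).
Proof.
rewrite -[X in _ --> X](mulr0 r); apply: cvgMr.
exact: cvg_harmonic.
Qed.

(** Given the past, the average has variance at most [C ^+ 2 / N.+1%:R] and follows its conditional
    mean; the localising event is the whole space. *)
Lemma cvp_lln y :
  cvp P (fun N o => cmean N.+1 (x N) (p N) K one g o) y ->
  cvp P (fun N o => N.+1%:R^-1 * \sum_t g (x N (lab N t o) o, z N t o)) y.
Proof.
move=> cy; have [mg [C gC]] := bg.
pose D N o := N.+1%:R^-1 * \sum_t g (x N (lab N t o) o, z N t o)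
  - cmean N.+1 (x N) (p N) K one g o.
have b1 N (j : 'I_N.+1) : bounded_meas ((fun _ => 1 : R) : g_sigma_algebraType (H N) -> R).
  exact: bounded_meas_cst.
have bst N t := bounded_stat _ _ _ _ _ _ _ _ (iid N) one g (b1 N) bg t.
have bm N := bounded_cmean _ _ _ _ _ _ _ _ (iid N) one g (b1 N) bg.
have sE N t o : g (x N (lab N t o) o, z N t o) =
    stat N.+1 (x N) (lab N) (z N) one g t o by rewrite /stat mul1r.
have bD N : bounded_meas (D N).
  apply: bounded_measB; last exact: (past_bounded_meas _ _ _ _ _ _ _ _ (iid N)).
  apply: bounded_measM; first exact: bounded_meas_cst.
  apply: bounded_meas_sum => t; apply: (bounded_meas_ext _ _ _ (bst N t)) => o.
  by rewrite -sE.
have c0 : cvp P D 0.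
  apply: (@cvp_chebyshev _ _ _ P D (fun N => setT) (fun N => C ^+ 2 / N.+1%:R)) => //.
  - rewrite (_ : (fun N => _) = cst 0%E); first exact: cvg_cst.
    by apply/funext => N; rewrite setCT measure0.
  - apply: nearW => N.
    have bc1 : bounded_meas ((fun _ => 1 : R) : g_sigma_algebraType (H N) -> R).
      exact: bounded_meas_cst.
    have := lln_moment _ _ _ _ _ _ _ _ (iid N) (fun _ => 1) one g N.+1 bc1
      (fun _ => ler01) (b1 N) bg (leqnn _).
    set U := (X in rint _ X <= _ -> _); set V := (X in _ <= _ * rint _ X -> _).
    have -> : (fun o => \1_[set: Om N] o * D N o ^+ 2) =
        (fun o => N.+1%:R^-1 ^+ 2 * U o).
      apply/funext => o; rewrite indicT mul1r /U mul1r psum_full sumrB.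
      rewrite sumr_const card_ord -(mulr_natl (cmean _ _ _ _ _ _ o)) -exprMn mulrBr.
      rewrite mulrA mulVf ?mul1r ?pnatr_eq0//; congr ((_ * _ - _) ^+ 2).
      by apply: eq_bigr => t _; rewrite sE.
    have bU : bounded_meas U.
      apply: bounded_measM; first exact: bounded_meas_cst.
      apply: bounded_measX; rewrite (_ : psum _ _ _ = fun o => \sum_i
        (stat N.+1 (x N) (lab N) (z N) one g i o - cmean N.+1 (x N) (p N) K one g o)).
        apply: bounded_meas_sum => i; apply: bounded_measB; first exact: bst.
        exact: (past_bounded_meas _ _ _ _ _ _ _ _ (iid N)).
      by apply/funext => o; rewrite psum_full.
    rewrite (rintZ (P N) _ U bU) => hU.
    have hV : rint (P N) V <= C ^+ 2.
      have bV : bounded_meas V.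
        apply: bounded_measM; first exact: bounded_meas_cst.
        apply: (past_bounded_meas _ _ _ _ _ _ _ _ (iid N)).
        apply: (bounded_cmean _ _ _ _ _ _ _ _ (iid N)).
          by move=> j; exact: (bounded_measX _ 2 (b1 N j)).
        exact: bounded_measX.
      apply: rint_prob_le => // o; rewrite /V mul1r (le_trans (ler_norm _))//.
      apply: (le_trans (cmean_bound _ _ _ _ _ _ _ _ (iid N) _ _ (C ^+ 2) o _ _ _)) => //.
      - exact: (bounded_measX _ 2 bg).1.
      - by move=> q; rewrite normrX lerXn2r ?nnegrE// (le_trans _ (gC q)).
      under eq_bigr do rewrite expr1n mulr1.
      by have [_ [_ [_ [_ [_ [_ [-> _]]]]]]] := iid N; rewrite mulr1.
    apply: (le_trans (ler_wpM2l (sqr_ge0 _) hU)).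
    rewrite expr2 mulrA -(mulrA N.+1%:R^-1) mulVf ?pnatr_eq0// mulr1 mulrC.
    by rewrite ler_wpM2r ?invr_ge0.
  - exact: cvg_cst_natSinv.
have := cvpD _ _ _ _ _ c0 cy; rewrite add0r.
apply: cvp_ext; last by apply: nearW => N o; rewrite /D subrK.
move=> N; apply: (bounded_measM _ _ (bounded_meas_cst N.+1%:R^-1) _).1.
apply: bounded_meas_sum => t; apply: (bounded_meas_ext _ _ _ (bst N t)) => o.
by rewrite -sE.
Qed.

Variable E : forall N, 'I_N.+1 -> Om N -> 'I_N.+1.
Hypothesis bE : forall N e j,
  bounded_meas (fun o : g_sigma_algebraType (H N) => (E N j o == e)%:R : R).

Local Notation d N e := (fun (j : 'I_N.+1) (o : Om N) => (E N j o == e)%:R : R).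

(** The third limit is there to localise: it makes the sum of the squared cluster probabilities of
    order [1 / N] with probability tending to 1. The diagonal then tends to [y], the off-diagonal
    part to [v]. *)
Lemma cvp_cluster y v kap :
  cvp P (fun N o => cmean N.+1 (x N) (p N) K one (fun q => g q ^+ 2) o) y ->
  cvp P (fun N o => N.+1%:R * \sum_e cmean N.+1 (x N) (p N) K (d N e) g o ^+ 2) v ->
  cvp P (fun N o => N.+1%:R * \sum_e cluster_prob N.+1 (p N) (E N) e o ^+ 2) kap ->
  cvp P (fun N o => N.+1%:R^-1 * \sum_e (\sum_t
    stat N.+1 (x N) (lab N) (z N) (d N e) g t o) ^+ 2) (y + v).
Proof.
move=> cy cv ck; have [mg [C gC]] := bg.
have C0 : 0 <= C by rewrite (le_trans _ (gC point)).
(* The threshold exceeds the limit [kap] and is nonnegative, as [cluster_moment] requires. *)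
pose A N := [set o | N.+1%:R * \sum_e cluster_prob N.+1 (p N) (E N) e o ^+ 2 <= `|kap| + 1].
have b1 N (j : 'I_N.+1) : bounded_meas ((fun _ => 1 : R) : g_sigma_algebraType (H N) -> R).
  exact: bounded_meas_cst.
have bst N e t := bounded_stat _ _ _ _ _ _ _ _ (iid N) (d N e) g (bE N e) bg t.
have bmu N e := past_bounded_meas _ _ _ _ _ _ _ _ (iid N) _
  (bounded_cmean _ _ _ _ _ _ _ _ (iid N) (d N e) g (bE N e) bg).
have bg2 : bounded_meas (fun q => g q ^+ 2) by exact: bounded_measX.
have bm N := past_bounded_meas _ _ _ _ _ _ _ _ (iid N) _
  (bounded_cmean _ _ _ _ _ _ _ _ (iid N) one _ (b1 N) bg2).
(* [A N] must belong to the past for its indicator to be a valid weight [c]. *)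
have mAH N : @measurable _ (g_sigma_algebraType (H N)) (A N).
  rewrite -[A N]setTI; apply: (@measurable_fun_le _ (g_sigma_algebraType (H N))) => //.
  apply: measurable_funM => //; apply: measurable_sum => e; apply: measurable_funX.
  apply: measurable_sum => j; apply: measurable_funM; last exact: (bE N e j).1.
  by have [_ [_ [_ [_ [+ _]]]]] := iid N; exact.
have mA N : measurable (A N).
  by apply/(@measurable_indicP _ _ R)/(past_bounded_meas _ _ _ _ _ _ _ _ (iid N) _
    (bounded_meas_indic _ (mAH N))).1.
pose D N o := N.+1%:R^-1 * (\sum_e (\sum_t
    stat N.+1 (x N) (lab N) (z N) (d N e) g t o) ^+ 2)
  - cmean N.+1 (x N) (p N) K one (fun q => g q ^+ 2) o
  - (N.+1%:R - 1) * \sum_e cmean N.+1 (x N) (p N) K (d N e) g o ^+ 2.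
have bQ N : bounded_meas (fun o => N.+1%:R^-1 * (\sum_e (\sum_t
    stat N.+1 (x N) (lab N) (z N) (d N e) g t o) ^+ 2)).
  apply: bounded_measM; first exact: bounded_meas_cst.
  apply: bounded_meas_sum => e; apply: bounded_measX.
  by apply: bounded_meas_sum => t; exact: bst.
have bD N : bounded_meas (D N).
  apply: bounded_measB; first by apply: bounded_measB.
  apply: bounded_measM; first exact: bounded_meas_cst.
  by apply: bounded_meas_sum => e; exact: bounded_measX.
have cD : cvp P D 0.
  apply: (@cvp_chebyshev _ _ _ P D A (fun N => C ^+ 4 * (3 * (4 * (`|kap| + 1) + 1) / N.+1%:R
     + 12 * (`|kap| + 1) * Num.sqrt ((`|kap| + 1) / N.+1%:R)))) => //.
  - by apply: (cvp_le_bound _ _ _ _ ck); rewrite (le_lt_trans (ler_norm _))// ltrDl.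
  - apply: nearW => N; apply: (cluster_moment _ _ _ _ _ _ _ _ (iid N)) => //.
    + exact: (bounded_meas_indic _ (mAH N)).
    move=> o; rewrite indicE; case: (boolP (o \in A N)) => oA; [right|by left].
    by split => //; move: oA; rewrite inE.
  - rewrite -[X in _ --> X](mulr0 (C ^+ 4)); apply: cvgMr.
    rewrite -[X in _ --> X](addr0 0); apply: cvgD; first exact: cvg_cst_natSinv.
    rewrite -[X in _ --> X](mulr0 (12 * (`|kap| + 1))); apply: cvgMr.
    rewrite -[X in _ --> X](@sqrtr0 R).
    apply: (cvg_comp _ _ (cvg_cst_natSinv (`|kap| + 1))).
    exact: (@sqrt_continuous R 0).
(* Passes from the coefficient [N.+1%:R - 1] of the off-diagonal mean to the [N.+1%:R] of the
   hypothesis. *)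
have cr : cvp P (fun N _ => 1 - 1 / N.+1%:R) 1.
  apply: cvp_real; rewrite -[X in _ --> X](subr0 1); apply: cvgB; first exact: cvg_cst.
  exact: cvg_cst_natSinv.
have := cvpD _ _ _ _ _ (cvpD _ _ _ _ _ cD cy) (cvpM _ _ _ _ _ cr cv).
rewrite add0r mul1r; apply: cvp_ext.
  by move=> N; exact: (bQ N).1.
apply: nearW => N o; rewrite /D.
have NN : N.+1%:R != 0 :> R by rewrite pnatr_eq0.
by move: (N.+1%:R) NN => n NN; field.
Qed.
End CondIidLimits.

(** * Limits for the particle filter *)

Lemma rint_density {R : realType} {d} {T : measurableType d}
    (chi nu : {finite_measure set T -> \bar R}) (r f : T -> R) :
  bounded_meas r -> (forall A, measurable A -> chi A = (\int[nu]_(x in A) (r x)%:E)%E) ->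
  bounded_meas f -> rint chi f = rint nu (fun x => r x * f x).
Proof.
move=> br chiE bf.
have bc := bc_functionalB _ _ (bc_rint chi)
  (bc_functional_weighted nu r id br (@measurable_id _ _ setT)).
have hA A : measurable A -> rint chi \1_A - rint nu (fun x => r x * \1_A x) = 0.
  move=> mA; rewrite rint_indic// chiE// /rint integral_mkcond.
  apply/eqP; rewrite subr_eq0; apply/eqP; congr fine; apply: eq_integral => x _.
  by rewrite patchE indicE; case: (_ \in _); rewrite ?mulr1 ?mulr0.
apply/eqP; rewrite -subr_eq0; apply/eqP.
apply: (bc_functional_eq0 _ bc measurable) => //.
- by rewrite sigma_algebra_id//; exact: sigma_algebra_measurable.
- exact: measurableI.
- by have := hA setT measurableT; rewrite indicT.
Qed.

Section APFLimits.
Context {R : realType} {dX : nat -> measure_display}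
  {X : forall n, measurableType (dX n)}.
Variables (L : forall n, R.-fker (X n) ~> (X n.+1))
  (chi : {finite_measure set (X 0%N) -> \bar R}) (nu : probability (X 0%N) R).
Variables (wm1 : X 0%N -> R) (theta : forall n, X n -> R)
  (Pk : forall n, R.-pker (X n) ~> (X n.+1)) (w : forall n, X n -> X n.+1 -> R).
Hypothesis Hnorm : forall n, 0 < chiL L chi n (fun _ => 1).
Hypothesis Hwm1 : measurable_fun setT wm1 /\ (forall x, 0 < wm1 x) /\
  exists M : R, forall x, wm1 x <= M.
Hypothesis Hchi : forall A, measurable A -> chi A = (\int[nu]_(x in A) (wm1 x)%:E)%E.
Hypothesis Htheta : forall n, measurable_fun setT (theta n) /\
  (forall x, 0 < theta n x) /\ exists M : R, forall x, theta n x <= M.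
Hypothesis Hw : forall n,
  measurable_fun setT (fun p : X n * X n.+1 => w n p.1 p.2) /\
  (forall x y, 0 < w n x y) /\ exists M : R, forall x y, w n x y / theta n x <= M.
Hypothesis HLP : forall n x (h : X n.+1 -> R), bounded_meas h ->
  (\int[L n x]_y (h y)%:E = \int[Pk n x]_y (h y * w n x y)%:E)%E.
Context {dO : nat -> measure_display} {Om : forall N, measurableType (dO N)}.
Variables (P : forall N, probability (Om N) R)
  (xi : forall N k : nat, 'I_N.+1 -> Om N -> X k)
  (I : forall N k : nat, 'I_N.+1 -> Om N -> 'I_N.+1).
Hypothesis HAPF : forall N, is_APF wm1 theta w N.+1 (xi N) (I N) nu Pk (P N).

Local Notation om N := (omega wm1 theta w N.+1 (xi N) (I N)).
Local Notation sp N := (selprob wm1 theta w N.+1 (xi N) (I N)).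
Local Notation wr := (wratio theta w).
Local Notation chiL := (chiL L chi).
Local Notation one := (fun _ _ => 1 : R).

Let bth n : bounded_meas (theta n). Proof. exact: bounded_meas_theta. Qed.
Let bwr n : bounded_meas (wr n). Proof. exact: bounded_meas_wratio. Qed.
Let th0 n x : 0 < theta n x. Proof. by case: (Htheta n) => _ []. Qed.

Definition Amean k (f : X k -> R) N (o : Om N) : R :=
  N.+1%:R^-1 * \sum_i om N k i o * f (xi N k i o).

Definition Qclust l k (f : X k -> R) N (o : Om N) : R :=
  N.+1%:R^-1 * \sum_e (\sum_(j | Enoch N.+1 (I N) l k j o == e)
     om N k j o * f (xi N k j o)) ^+ 2.

(** The scale of the weights at time [n]: selection divides by the weighted mean of [theta], in
    which the scale of the preceding generation cancels, so only the last selection is remembered.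
    The initial weights have scale 1. *)
Definition kappa (n : nat) : R := if n is k.+1 then chiL k (theta k) else 1.

Lemma chiL_theta_gt0 n : 0 < chiL n (theta n).
Proof. exact: chiL_gt0. Qed.

Lemma kappa_gt0 n : 0 < kappa n.
Proof. by case: n => [|n] /=; [exact: ltr01|exact: chiL_theta_gt0]. Qed.

Definition wf n (f : X n.+1 -> R) (q : X n * X n.+1) : R := wr n q * f q.2.

Lemma bounded_wf n f : bounded_meas f -> bounded_meas (wf n f).
Proof. by move=> bf; apply: bounded_measM => //; exact: bounded_meas_comp. Qed.

Let sec n (g : X n * X n.+1 -> R) x : bounded_meas g -> bounded_meas (fun y => g (x, y)).
Proof. by move=> [mg [M gM]]; split; [exact: measurable_fun_pair2|exists M]. Qed.

(** Selection multiplies by [theta] and the weight of the child divides by it; what is left is the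
    importance weight [w], which turns [Pk] into [L]. *)
Lemma theta_Pk_wf n f x : bounded_meas f ->
  theta n x * rint (Pk n x) (fun y => wf n f (x, y)) = Lop L n f x.
Proof.
move=> bf; rewrite -(rintZ (fker_measure (Pk n) x)); last exact/sec/bounded_wf.
rewrite /Lop /rint HLP//; congr fine; apply: eq_integral => y _; congr EFin.
by rewrite /wf /wratio/=; field; rewrite gt_eqF.
Qed.

Lemma theta_Pk_wf_sqr n f x : bounded_meas f ->
  theta n x * rint (Pk n x) (fun y => wf n f (x, y) ^+ 2) = onestep_var L theta w n f x.
Proof.
move=> bf; have bwf := sec n _ x (bounded_wf n f bf).
(* At fixed [x] the weight [w n x] is bounded, so [HLP] applies to [w * f ^+ 2] and absorbs one of
   the two factors [w] into [L]. *)
have bw : bounded_meas (fun y => w n x y).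
  have -> : (fun y => w n x y) = (fun y => theta n x * wr n (x, y)).
    by apply/funext => y; rewrite /wratio/=; field; rewrite gt_eqF.
  by apply: bounded_measM; [exact: bounded_meas_cst|exact: sec].
have bwf2 : bounded_meas (fun y => w n x y * f y ^+ 2).
  by apply: bounded_measM => //; exact: bounded_measX.
have bwwf : bounded_meas (fun y => w n x y * f y ^+ 2 * w n x y).
  exact: bounded_measM.
have -> : onestep_var L theta w n f x =
    (theta n x)^-1 * rint (fker_measure (Pk n) x) (fun y => w n x y * f y ^+ 2 * w n x y).
  by rewrite /onestep_var /rint HLP.
rewrite -rintZ//.
transitivity (rint (fker_measure (Pk n) x) (fun y => theta n x * wf n f (x, y) ^+ 2)).
  by rewrite rintZ//; exact: bounded_measX.
by congr rint; apply/funext => y; rewrite /wf /wratio/=; field; rewrite gt_eqF.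
Qed.

Lemma bounded_onestep_var n f : bounded_meas f -> bounded_meas (onestep_var L theta w n f).
Proof.
move=> bf; have -> : onestep_var L theta w n f =
    (fun x => theta n x * rint (Pk n x) (fun y => wf n f (x, y) ^+ 2)).
  by apply/funext => x; rewrite theta_Pk_wf_sqr.
apply: bounded_measM => //.
apply: (bounded_meas_rint_fker (Pk n) (fun q => wf n f q ^+ 2)).
exact/bounded_measX/bounded_wf.
Qed.

Let sumth_gt0 N k o : 0 < \sum_i om N k i o * theta k (xi N k i o).
Proof. exact: sum_omega_gt0. Qed.

Lemma cmean_Amean N k (g : X k * X k.+1 -> R) (f : X k -> R) o :
  (forall x, theta k x * rint (Pk k x) (fun y => g (x, y)) = f x) ->
  cmean N.+1 (xi N k) (sp N k) (Pk k) one g o = Amean k f N o / Amean k (theta k) N o.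
Proof.
move=> gf; rewrite /Amean invfM mulrACA mulfV ?invr_eq0 ?pnatr_eq0// mul1r mulr_suml /cmean.
apply: eq_bigr => j _; rewrite mul1r -gf /selprob; ring.
Qed.

(** All selection probabilities share the denominator [S], which leaves every cluster sum as a
    common factor; this is how the off-diagonal mean becomes the same functional of the parent
    generation. *)
Lemma cmean_Qclust N l k (g : X k * X k.+1 -> R) (f : X k -> R) o :
  (forall x, theta k x * rint (Pk k x) (fun y => g (x, y)) = f x) ->
  N.+1%:R * \sum_e cmean N.+1 (xi N k) (sp N k) (Pk k)
    (fun j o => (Enoch N.+1 (I N) l k j o == e)%:R) g o ^+ 2 =
  Qclust l k f N o / Amean k (theta k) N o ^+ 2.
Proof.
move=> gf; pose S := \sum_i om N k i o * theta k (xi N k i o).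
have S0 : S != 0 by rewrite gt_eqF // sumth_gt0.
have cE e : cmean N.+1 (xi N k) (sp N k) (Pk k)
    (fun j o => (Enoch N.+1 (I N) l k j o == e)%:R) g o =
    S^-1 * \sum_(j | Enoch N.+1 (I N) l k j o == e) om N k j o * f (xi N k j o).
  rewrite mulr_sumr big_mkcond/=; apply: eq_bigr => j _.
  case: ifP => _; last by rewrite mul0r mulr0.
  by rewrite mul1r -gf /selprob -/S; ring.
under eq_bigr do rewrite cE exprMn.
rewrite -mulr_sumr /Qclust /Amean -/S.
have NN : N.+1%:R != 0 :> R by rewrite pnatr_eq0.
by move: (N.+1%:R) NN => n NN; field; rewrite S0 NN.
Qed.

Lemma cluster_prob_Qclust N l k o :
  N.+1%:R * \sum_e cluster_prob N.+1 (sp N k) (Enoch N.+1 (I N) l k) e o ^+ 2 =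
  Qclust l k (theta k) N o / Amean k (theta k) N o ^+ 2.
Proof.
pose S := \sum_i om N k i o * theta k (xi N k i o).
have S0 : S != 0 by rewrite gt_eqF // sumth_gt0.
have cE e : cluster_prob N.+1 (sp N k) (Enoch N.+1 (I N) l k) e o =
    S^-1 * \sum_(j | Enoch N.+1 (I N) l k j o == e) om N k j o * theta k (xi N k j o).
  rewrite mulr_sumr big_mkcond/=; apply: eq_bigr => j _.
  case: ifP => _; last by rewrite mulr0.
  by rewrite mulr1 /selprob -/S mulrC.
under eq_bigr do rewrite cE exprMn.
rewrite -mulr_sumr /Qclust /Amean -/S.
have NN : N.+1%:R != 0 :> R by rewrite pnatr_eq0.
by move: (N.+1%:R) NN => n NN; field; rewrite S0 NN.
Qed.

Let measurable_om N k i : measurable_fun setT (om N k i).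
Proof.
apply: (measurable_fun_hist _ _ _ _ _ _ _ _ _ (HAPF N) k).
exact: (bounded_omega wm1 theta w Hwm1 Htheta Hw _ (xi N) (I N) k i).1.
Qed.

Let bounded_Enoch N l k e j :
  bounded_meas (fun o : g_sigma_algebraType (history_gen N.+1 (xi N) (I N) k) =>
    (Enoch N.+1 (I N) l k j o == e)%:R : R).
Proof. by apply: bounded_meas_preimage; exact: Enoch_hist. Qed.

Lemma measurable_Qclust l k f N : bounded_meas f -> measurable_fun setT (Qclust l k f N).
Proof.
move=> bf; apply: measurable_funM => //; apply: measurable_sum => e.
apply: measurable_funX.
rewrite (_ : (fun o => _) = (fun o => \sum_j (Enoch N.+1 (I N) l k j o == e)%:R *
    (om N k j o * f (xi N k j o)))); last first.
  apply/funext => o; rewrite big_mkcond/=; apply: eq_bigr => j _.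
  by case: ifP; rewrite ?mul1r ?mul0r.
apply: measurable_sum => j; apply: measurable_funM.
  apply: (measurable_fun_hist _ _ _ _ _ _ _ _ _ (HAPF N) k).
  exact: (bounded_Enoch N l k e j).1.
apply: measurable_funM => //; apply: measurableT_comp; first exact: bf.1.
by have [mxi _] := HAPF N; exact: mxi.
Qed.

Let step_iid k N : cond_iid (P N) N.+1 (history_gen N.+1 (xi N) (I N) k)
  (xi N k) (I N k) (xi N k.+1) (sp N k) (Pk k).
Proof. exact: (APF_cond_iid wm1 theta w nu). Qed.

(** The conditional mean of the new average is a ratio of averages over the previous generation, at
    [Lop L n f] and at [theta n]. *)
Lemma cvp_Amean n f : bounded_meas f -> cvp P (Amean n f) (chiL n f / kappa n).
Proof.
elim: n f => [|n IH] f bf.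
  have bw := bounded_meas_wm1 _ Hwm1.
  pose g (q : unit * X 0%N) := wm1 q.2 * f q.2.
  have bg : bounded_meas g.
    by apply: (bounded_meas_comp (fun x => wm1 x * f x) snd) => //; exact: bounded_measM.
  have := cvp_lln P _ _ _ _ _ _ g (fun N => init_cond_iid wm1 theta w nu Pk N.+1
    (ltn0Sn N) (P N) (xi N) (I N) (HAPF N)) bg (chiL 0 f / kappa 0).
  rewrite /kappa invr1 mulr1 chiL0 (rint_density chi nu wm1)//.
  apply; apply: cvp_ext (cvp_cst P _).
    move=> N; apply: measurable_sum => j; apply: measurable_funM => //.
  apply: nearW => N o; rewrite /cmean (bigD1 (Ordinal (ltn0Sn N)))//= !mul1r big1 ?addr0//.
  by move=> j /negbTE ->; rewrite mul0r.
have Lb := bounded_Lop L n f bf.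
have cm : cvp P (fun N o => cmean N.+1 (xi N n) (sp N n) (Pk n) one (wf n f) o)
    (chiL n.+1 f / kappa n.+1).
  have -> : chiL n.+1 f / kappa n.+1 =
      (chiL n (Lop L n f) / kappa n) * (chiL n (theta n) / kappa n)^-1.
    rewrite chiLS /=; field; rewrite gt_eqF ?kappa_gt0// gt_eqF// chiL_theta_gt0//.
  have := cvpM _ _ _ _ _ (IH _ Lb) (cvpV _ _ _ _ (IH _ (bth n))).
  have -> : (fun N o => cmean N.+1 (xi N n) (sp N n) (Pk n) one (wf n f) o) =
    (fun N o => Amean n (Lop L n f) N o * (Amean n (theta n) N o)^-1).
    apply: functional_extensionality_dep => N; apply/funext => o; apply: cmean_Amean => x.
    exact: theta_Pk_wf.
  by apply; rewrite gt_eqF// divr_gt0 ?kappa_gt0 ?chiL_theta_gt0.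
have := cvp_lln P _ _ _ _ _ _ (wf n f) (step_iid n) (bounded_wf n f bf) _ cm.
by [].
Qed.

Lemma cvp_cmean_sqr n f : bounded_meas f ->
  cvp P (fun N o => cmean N.+1 (xi N n) (sp N n) (Pk n) one (fun q => wf n f q ^+ 2) o)
    (chiL n (onestep_var L theta w n f) / chiL n (theta n)).
Proof.
move=> bf; have ob := bounded_onestep_var n f bf.
have -> : chiL n (onestep_var L theta w n f) / chiL n (theta n) =
    (chiL n (onestep_var L theta w n f) / kappa n) * (chiL n (theta n) / kappa n)^-1.
  field; rewrite gt_eqF ?kappa_gt0// gt_eqF// chiL_theta_gt0//.
have := cvpM _ _ _ _ _ (cvp_Amean n _ ob) (cvpV _ _ _ _ (cvp_Amean n _ (bth n))).
have -> : (fun N o => cmean N.+1 (xi N n) (sp N n) (Pk n) one (fun q => wf n f q ^+ 2) o) =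
  (fun N o => Amean n (onestep_var L theta w n f) N o * (Amean n (theta n) N o)^-1).
  apply: functional_extensionality_dep => N; apply/funext => o; apply: cmean_Amean => x.
  exact: theta_Pk_wf_sqr.
by apply; rewrite gt_eqF// divr_gt0 ?kappa_gt0 ?chiL_theta_gt0.
Qed.

Lemma Enoch_diag N n i o : Enoch N.+1 (I N) n n i o = i.
Proof. by case: n => [|n] //=; rewrite ltnn. Qed.

Lemma Qclust_diag n f N o : Qclust n n f N o =
  N.+1%:R^-1 * \sum_j (om N n j o * f (xi N n j o)) ^+ 2.
Proof.
congr (_ * _); apply: eq_bigr => e _; congr (_ ^+ 2).
under eq_bigl do rewrite Enoch_diag.
by rewrite big_pred1_eq.
Qed.

(** Induction on [n] from the tracing time [l], for all bounded [f] at once: the step calls the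
    hypothesis at [Lop L n f] for the limit and at [theta n] for the localisation. *)
Lemma cvp_Qclust l n f : (l <= n)%N -> bounded_meas f ->
  cvp P (Qclust l n f) (unnorm_var L chi wm1 theta w l n f / kappa n ^+ 2).
Proof.
(* At the tracing time every cluster is a singleton, so the functional is an average of squares and
   the law of large numbers suffices. *)
have diag n0 f0 : bounded_meas f0 ->
    cvp P (Qclust n0 n0 f0) (unnorm_var L chi wm1 theta w n0 n0 f0 / kappa n0 ^+ 2).
  case: n0 f0 => [|k] f0 bf.
    rewrite unnorm_var0 /kappa expr1n invr1 mulr1.
    have bwf : bounded_meas (fun x => wm1 x * f0 x ^+ 2).
      by apply: bounded_measM; [exact: bounded_meas_wm1|exact: bounded_measX].
    have := cvp_Amean 0 _ bwf; rewrite /kappa invr1 mulr1.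
    apply: cvp_ext; first by move=> N; exact: measurable_Qclust.
    apply: nearW => N o; rewrite Qclust_diag; congr (_ * _).
    by apply: eq_bigr => j _ /=; ring.
  rewrite unnorm_var_diag /kappa.
  have -> : chiL k (theta k) * chiL k (onestep_var L theta w k f0) / chiL k (theta k) ^+ 2 =
      chiL k (onestep_var L theta w k f0) / chiL k (theta k).
    by field; rewrite gt_eqF// chiL_theta_gt0.
  have bg2 := bounded_measX _ 2 (bounded_wf k f0 bf).
  have := cvp_lln P _ _ _ _ _ _ _ (step_iid k) bg2 _ (cvp_cmean_sqr k f0 bf).
  apply: cvp_ext; first by move=> N; exact: measurable_Qclust.
  by apply: nearW => N o; rewrite Qclust_diag.
elim: n f => [|n IH] f ln bf.
  by move: ln; rewrite leqn0 => /eqP ->; exact: diag.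
move: ln; rewrite leq_eqVlt => /predU1P[->|ln]; first exact: diag.
have Lb := bounded_Lop L n f bf.
have A0 : chiL n (theta n) / kappa n != 0.
  by rewrite gt_eqF// divr_gt0 ?kappa_gt0 ?chiL_theta_gt0.
have cA := cvpV _ _ _ A0 (cvp_Amean n _ (bth n)).
have cA2 := cvpM _ _ _ _ _ cA cA.
have cv : cvp P (fun N o => N.+1%:R * \sum_e cmean N.+1 (xi N n) (sp N n) (Pk n)
    (fun j o => (Enoch N.+1 (I N) l n j o == e)%:R) (wf n f) o ^+ 2)
    (unnorm_var L chi wm1 theta w l n (Lop L n f) / kappa n ^+ 2 *
      ((chiL n (theta n) / kappa n)^-1 * (chiL n (theta n) / kappa n)^-1)).
  have := cvpM _ _ _ _ _ (IH _ ln Lb) cA2; apply: cvp_eq => N o.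
  rewrite (cmean_Qclust N l n _ (Lop L n f)) ?expr2 ?invfM// => x.
  exact: theta_Pk_wf.
have ck : cvp P (fun N o => N.+1%:R * \sum_e
    cluster_prob N.+1 (sp N n) (Enoch N.+1 (I N) l n) e o ^+ 2)
    (unnorm_var L chi wm1 theta w l n (theta n) / kappa n ^+ 2 *
      ((chiL n (theta n) / kappa n)^-1 * (chiL n (theta n) / kappa n)^-1)).
  have := cvpM _ _ _ _ _ (IH _ ln (bth n)) cA2; apply: cvp_eq => N o.
  by rewrite cluster_prob_Qclust -exprVn expr2.
have := cvp_cluster P _ _ _ _ _ _ (wf n f) (step_iid n) (bounded_wf n f bf)
  (fun N => Enoch N.+1 (I N) l n) (fun N e j => bounded_Enoch N l n e j) _ _ _
  (cvp_cmean_sqr n f bf) cv ck.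
rewrite unnorm_varS//.
(* Division by the square of the limit of [Amean] at [theta n] exchanges [kappa n] for
   [kappa n.+1]. *)
have -> : (unnorm_var L chi wm1 theta w l n (Lop L n f) +
    chiL n (theta n) * chiL n (onestep_var L theta w n f)) / kappa n.+1 ^+ 2 =
  chiL n (onestep_var L theta w n f) / chiL n (theta n) +
  unnorm_var L chi wm1 theta w l n (Lop L n f) / kappa n ^+ 2 *
      ((chiL n (theta n) / kappa n)^-1 * (chiL n (theta n) / kappa n)^-1).
  by rewrite /=; field; rewrite !gt_eqF ?kappa_gt0 ?chiL_theta_gt0.
apply: cvp_ext; first by move=> N; exact: measurable_Qclust.
apply: nearW => N o; congr (_ * _); apply: eq_bigr => e _; congr (_ ^+ 2).
rewrite [RHS]big_mkcond/=; apply: eq_bigr => t _.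
have -> : (l <= n)%N by [].
by rewrite /stat; case: ifP; rewrite ?mul1r ?mul0r.
Qed.

(* Polarisation: the cross term is recovered from [Q] at [f + 1] and [f - 1], so that only
   convergence of [Q] at fixed functions is needed. *)
Lemma Qclust_shift l n f r N o : Qclust l n (fun x => f x - r) N o =
  Qclust l n f N o - r * ((Qclust l n (fun x => f x + 1) N o -
    Qclust l n (fun x => f x - 1) N o) / 2) + r ^+ 2 * Qclust l n (fun _ => 1) N o.
Proof.
pose S (f : X n -> R) e := \sum_(j | Enoch N.+1 (I N) l n j o == e) om N n j o * f (xi N n j o).
have QE f0 : Qclust l n f0 N o = N.+1%:R^-1 * \sum_e S f0 e ^+ 2 by [].
have SD a : \sum_e S (fun x => f x + a) e ^+ 2 = \sum_e S f e ^+ 2 +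
    2 * a * (\sum_e S f e * S (fun _ => 1) e) + a ^+ 2 * \sum_e S (fun _ => 1) e ^+ 2.
  rewrite !mulr_sumr -!big_split/=; apply: eq_bigr => e _.
  have -> : S (fun x => f x + a) e = S f e + a * S (fun _ => 1) e.
    by rewrite /S mulr_sumr -big_split/=; apply: eq_bigr => j _; ring.
  by ring.
by rewrite !QE !SD; field.
Qed.

Lemma sigma_hatE n lam h N o : sigma_hat wm1 theta w N.+1 (xi N) (I N) n lam h o =
  Qclust (n - lam) n (fun x => h x - Amean n h N o / Amean n (fun _ => 1) N o) N o /
    Amean n (fun _ => 1) N o ^+ 2.
Proof.
have NN : N.+1%:R != 0 :> R by rewrite pnatr_eq0.
have OE : Omega wm1 theta w N.+1 (xi N) (I N) n o = \sum_i om N n i o * 1.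
  by apply: eq_bigr => i _; rewrite mulr1.
have O0 : \sum_i om N n i o * 1 != 0.
  by rewrite gt_eqF//; apply: (sum_omega_gt0 _ _ _ Hwm1 Htheta Hw _ _ _ _ _ (fun _ => 1)).
have eE : etaN wm1 theta w N.+1 (xi N) (I N) n h o = Amean n h N o / Amean n (fun _ => 1) N o.
  rewrite /etaN -mulr_suml OE /Amean.
  by move: (N.+1%:R) NN => m NN; field; rewrite O0 NN.
rewrite /sigma_hat /Qclust eE OE.
set r := Amean n h N o / _.
have -> : Amean n (fun _ => 1) N o = N.+1%:R^-1 * \sum_i om N n i o * 1 by [].
set S := \sum_i _ * 1; rewrite -/S in O0.
under eq_bigr => e _.
  rewrite (_ : \sum_(j | _) _ = S^-1 * \sum_(j | Enoch N.+1 (I N) (n - lam) n j o == e)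
    om N n j o * (h (xi N n j o) - r)); last first.
    by rewrite mulr_sumr; apply: eq_bigr => j _; ring.
  rewrite exprMn; over.
rewrite -mulr_sumr.
by move: (N.+1%:R) NN => m NN; field; rewrite O0 NN.
Qed.

Lemma cvp_sigma_hat n lam h : bounded_meas h ->
  cvp P (fun N o => sigma_hat wm1 theta w N.+1 (xi N) (I N) n lam h o)
    (asym_var L chi wm1 theta w (n - lam) n h).
Proof.
move=> bh; rewrite asym_varE//.
set l := (n - lam)%N; set hc := fun x => h x - Defs.eta L chi n h.
have ln : (l <= n)%N by exact: leq_subr.
have b1 : bounded_meas (fun _ : X n => 1 : R) by exact: bounded_meas_cst.
have bhc : bounded_meas hc by apply: bounded_measB => //; exact: bounded_meas_cst.
have k0 := kappa_gt0 n.
have A0 : chiL n (fun _ => 1) / kappa n != 0 by rewrite gt_eqF// divr_gt0.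
have cA1 := cvpV _ _ _ A0 (cvp_Amean n _ b1).
have ceta := cvpM _ _ _ _ _ (cvp_Amean n _ bh) cA1.
have cr : cvp P (fun N o => Amean n h N o / Amean n (fun _ => 1) N o - Defs.eta L chi n h) 0.
  have := cvpB _ _ _ _ _ ceta (cvp_cst P (Defs.eta L chi n h)).
  by rewrite (_ : _ - _ = 0)// /Defs.eta; field; rewrite !gt_eqF.
have cQ f bf := cvp_Qclust l n f ln bf.
have c2 := cvp_cst P (2^-1).
have bp : bounded_meas (fun x => hc x + 1) by exact: bounded_measD.
have bm : bounded_meas (fun x => hc x - 1) by exact: bounded_measB.
(* The random shift of [hc] tends to 0, so the linear and quadratic terms of the expansion vanish in
   the limit, their coefficients being convergent. *)
have cmid := cvpM _ _ _ _ _ cr (cvpM _ _ _ _ _ (cvpB _ _ _ _ _ (cQ _ bp) (cQ _ bm)) c2).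
have csq := cvpM _ _ _ _ _ (cvpM _ _ _ _ _ cr cr) (cQ _ b1).
have := cvpM _ _ _ _ _ (cvpD _ _ _ _ _ (cvpB _ _ _ _ _ (cQ _ bhc) cmid) csq)
  (cvpM _ _ _ _ _ cA1 cA1).
rewrite !mul0r subr0 addr0.
rewrite (_ : _ / kappa n ^+ 2 * _ = unnorm_var L chi wm1 theta w l n hc /
  chiL n (fun=> 1) ^+ 2); last by field; rewrite !gt_eqF.
apply: cvp_eq => N o.
rewrite sigma_hatE -/l.
set r := Amean n h N o / _.
rewrite (_ : (fun x => h x - r) = (fun x => hc x - (r - Defs.eta L chi n h))); last first.
  by apply/funext => x; rewrite /hc; ring.
by rewrite (Qclust_shift l n hc (r - Defs.eta L chi n h)) -exprVn !expr2.
Qed.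
End APFLimits.

Theorem theorem2p2
  (R : realType)
  (dX : nat -> measure_display) (X : forall n, measurableType (dX n))
  (L : forall n, R.-fker (X n) ~> (X n.+1))
  (chi : {finite_measure set (X 0%N) -> \bar R})
  (nu : probability (X 0%N) R)
  (wm1 : X 0%N -> R)
  (theta : forall n, X n -> R)
  (Pk : forall n, R.-pker (X n) ~> (X n.+1))
  (w : forall n, X n -> X n.+1 -> R)
  (* normalising constants positive (finiteness: L_n are finite kernels) *)
  (Hnorm : forall n, 0 < chiL L chi n (fun _ => 1))
  (* w_{-1} = d chi / d nu *)
  (Hwm1 : measurable_fun setT wm1 /\ (forall x, 0 <= wm1 x) /\
          forall A, measurable A -> chi A = (\int[nu]_(x in A) (wm1 x)%:E)%E)
  (Htheta : forall n, measurable_fun setT (theta n) /\ forall x, 0 < theta n x)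
  (Hw : forall n, measurable_fun setT (fun p : X n * X n.+1 => w n p.1 p.2) /\
                  forall x y, 0 <= w n x y)
  (HLP : forall n x (h : X n.+1 -> R), bounded_meas h ->
         (\int[L n x]_y (h y)%:E = \int[Pk n x]_y (h y * w n x y)%:E)%E)
  (* (A1) *)
  (HA1 : (forall n, exists M : R, forall x, theta n x <= M) /\
         (forall n, exists M : R, forall x y, w n x y / theta n x <= M) /\
         (exists M : R, forall x, wm1 x <= M))
  (* (A2) *)
  (HA2 : (forall n x y, 0 < w n x y * theta n.+1 y / theta n x) /\
         (forall n, exists M : R, forall x y, w n x y * theta n.+1 y / theta n x <= M) /\
         (forall x, 0 < wm1 x * theta 0%N x) /\
         (exists M : R, forall x, wm1 x * theta 0%N x <= M))
  (* for each N, a probability space carrying the APF with N particles *)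
  (dO : nat -> measure_display) (Om : forall N, measurableType (dO N))
  (P : forall N, probability (Om N) R)
  (xi : forall N k : nat, 'I_N -> Om N -> X k)
  (I : forall N k : nat, 'I_N -> Om N -> 'I_N)
  (HAPF : forall N, is_APF wm1 theta w N (xi N) (I N) nu Pk (P N))
  (n lam : nat) (h : X n -> R) (Hh : bounded_meas h) :
  forall eps : R, 0 < eps ->
    (fun N => P N [set o | eps < `| sigma_hat wm1 theta w N (xi N) (I N) n lam h o
                              - asym_var L chi wm1 theta w (n - lam) n h | ])
      @ \oo --> 0%E.
Proof.
move=> eps eps0.
have [At [Aw [M wm1M]]] := HA1; have [A2w [_ [A2wm _]]] := HA2.
have [mwm1 [wm10 chiE]] := Hwm1.
have th0 k x : 0 < theta k x by exact: (Htheta k).2.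
(* As [theta] is positive, (A2) forces the positivity of [wm1] and [w] themselves. *)
have wm1_gt0 x : 0 < wm1 x by have := A2wm x; rewrite pmulr_lgt0.
have w_gt0 k x y : 0 < w k x y.
  by have := A2w k x y; rewrite pmulr_lgt0 ?invr_gt0// pmulr_lgt0.
have [_ H] := @cvp_sigma_hat R dX X L chi nu wm1 theta Pk w Hnorm
  (conj mwm1 (conj wm1_gt0 (ex_intro _ M wm1M))) chiE
  (fun k => conj (Htheta k).1 (conj (th0 k) (At k)))
  (fun k => conj (Hw k).1 (conj (w_gt0 k) (Aw k)))
  HLP (fun N => dO N.+1) (fun N => Om N.+1) (fun N => P N.+1)
  (fun N => xi N.+1) (fun N => I N.+1) (fun N => HAPF N.+1) n lam h Hh.
(* The limits are stated for [N.+1] particles, so that dividing by their number makes sense; the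
   shift of index does not affect the limit. *)
rewrite -cvg_shiftS; exact: H.
Qed.
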